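(* Let $n\ge1$ and $A,B\subseteq[1;n]$ with $B\subseteq A$. Then $\Gamma^q_A$ and $\Gamma^q_B$ commute in $\mathfrak{osp}_q(1|2)^{\otimes n}$.
   Context: Let $\mathbb{K}$ be a field, $q\in\mathbb{K}$ not a root of unity, with a fixed square root $q^{1/2}\in\mathbb{K}$. $\mathfrak{osp}_q(1|2)$ is the associative $\mathbb{K}$-algebra generated by $A_+,A_-,K,K^{-1},P$ with relations $KA_+K^{-1}=q^{1/2}A_+$, $KA_-K^{-1}=q^{-1/2}A_-$, $A_+A_-+A_-A_+=\frac{K^2-K^{-2}}{q^{1/2}-q^{-1/2}}$, $PA_\pm+A_\pm P=0$, $PK=KP$, $PK^{-1}=K^{-1}P$, $KK^{-1}=K^{-1}K=1$, $P^2=1$. Its Casimir element is $\Gamma^q=\big(-A_+A_-+\frac{q^{-1/2}K^2-q^{1/2}K^{-2}}{q-q^{-1}}\big)P$. The coproduct is the algebra morphism $\Delta$ with $\Delta(A_\pm)=A_\pm\otimes KP+K^{-1}\otimes A_\pm$, $\Delta(K^{\pm1})=K^{\pm1}\otimes K^{\pm1}$, $\Delta(P)=P\otimes P$. Let $\mathcal{I}_R$ be the subalgebra generated by $A_+K,A_-K,K^2P,\Gamma^q$ and $\tau_R:\mathcal{I}_R\to\mathfrak{osp}_q(1|2)\otimes\mathcal{I}_R$ the algebra morphism with $\tau_R(A_-K)=K^2P\otimes A_-K$, $\tau_R(A_+K)=K^{-2}P\otimes A_+K+q^{-1/2}(q-q^{-1})A_+^2P\otimes A_-K+q^{-1/2}(q^{1/2}-q^{-1/2})A_+K^{-1}P\otimes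 K^2P+q^{-1/2}(q-q^{-1})A_+K^{-1}P\otimes\Gamma^q$, $\tau_R(K^2P)=1\otimes K^2P-(q-q^{-1})A_+K\otimes A_-K$, $\tau_R(\Gamma^q)=1\otimes\Gamma^q$. For integers $i\le j$, $[i;j]=\{i,\dots,j\}$; $1^{\otimes\ell}\otimes\varphi\otimes1^{\otimes m}$ applies $\varphi$ to tensor position $\ell+1$. $\Gamma^q_\varnothing$ is a scalar, and for $A=\{a_1<\dots<a_m\}\subseteq[1;n]$, $\Gamma^q_A=1^{\otimes(a_1-1)}\otimes(\mu_m\circ\cdots\circ\mu_2)(\Gamma^q)\otimes1^{\otimes(n-a_m)}\in\mathfrak{osp}_q(1|2)^{\otimes n}$ with $\mu_i=(1^{\otimes(a_i-a_1-1)}\otimes\tau_R)\circ\cdots\circ(1^{\otimes(a_{i-1}-a_1+1)}\otimes\tau_R)\circ(1^{\otimes(a_{i-1}-a_1)}\otimes\Delta)$ (no $\tau_R$ factors when $a_i=a_{i-1}+1$). *)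

(* Defs.v *)
From HB Require Import structures.
From mathcomp Require Import all_boot all_order all_algebra.
From Stdlib Require Import ClassicalEpsilon.
Set Implicit Arguments. Unset Strict Implicit. Unset Printing Implicit Defensive.
Import GRing.Theory.
Local Open Scope ring_scope.

Inductive gen := GAp | GAm | GK | GKi | GP.

Inductive term (K V : Type) : Type :=
  | tvar of V
  | tconst of K
  | tadd of term K V & term K V
  | tmul of term K V & term K V.
Arguments tvar {K V} _.
Arguments tconst {K V} _.
Arguments tadd {K V} _ _.
Arguments tmul {K V} _ _.

Fixpoint tsubst {K V W : Type} (f : V -> term K W) (t : term K V) : term K W :=
  match t with
  | tvar x => f x
  | tconst c => tconst c
  | tadd a b => tadd (tsubst f a) (tsubst f b)
  | tmul a b => tmul (tsubst f a) (tsubst f b)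
  end.

Fixpoint teval {K : fieldType} {R : algType K} {V : Type} (f : V -> R)
  (t : term K V) : R :=
  match t with
  | tvar x => f x
  | tconst c => c%:A
  | tadd a b => teval f a + teval f b
  | tmul a b => teval f a * teval f b
  end.

Fixpoint tvars_ok {K V : Type} (P : V -> bool) (t : term K V) : bool :=
  match t with
  | tvar x => P x
  | tconst _ => true
  | tadd a b => tvars_ok P a && tvars_ok P b
  | tmul a b => tvars_ok P a && tvars_ok P b
  end.

(* Symbols for the generators A_+K, A_-K, K^2P, Gamma^q of I_R. *)
Inductive irgen := IRa | IRb | IRc | IRg.

Section Osp.
Variables (K : fieldType) (q12 : K).
Definition qq : K := q12 ^+ 2.
Definition qdiff : K := qq - qq^-1.

(* Elements of osp^{(x)n} are represented by terms in variables (i, g):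
   generator g in tensor position i (0-based). *)
Definition ov (i : nat) (g : gen) : term K (nat * gen) := tvar (i, g).

Definition Gamma_at {V : Type} (x : gen -> term K V) : term K V :=
  tmul (tadd (tmul (tconst (-1)) (tmul (x GAp) (x GAm)))
             (tmul (tconst qdiff^-1)
                   (tadd (tmul (tconst q12^-1) (tmul (x GK) (x GK)))
                         (tmul (tconst (- q12)) (tmul (x GKi) (x GKi))))))
       (x GP).

(* The defining relations of osp_q(1|2)^{(x)n} (tensor product of algebras:
   relations of each factor, and generators in distinct factors commute). *)
Definition osp_rel {R : algType K} (n : nat) (v : nat -> gen -> R) : Prop :=
  (forall i, (i < n)%N ->
     (v i GK * v i GAp * v i GKi = q12 *: v i GAp) /\
     (v i GK * v i GAm * v i GKi = q12^-1 *: v i GAm) /\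
     (v i GAp * v i GAm + v i GAm * v i GAp
        = (q12 - q12^-1)^-1 *: (v i GK * v i GK - v i GKi * v i GKi)) /\
     (v i GP * v i GAp + v i GAp * v i GP = 0) /\
     (v i GP * v i GAm + v i GAm * v i GP = 0) /\
     (v i GP * v i GK = v i GK * v i GP) /\
     (v i GP * v i GKi = v i GKi * v i GP) /\
     (v i GK * v i GKi = 1) /\
     (v i GKi * v i GK = 1) /\
     (v i GP * v i GP = 1)) /\
  (forall i j, (i < n)%N -> (j < n)%N -> i != j ->
     forall g h, v i g * v j h = v j h * v i g).

(* Equality in the presented algebra osp_q(1|2)^{(x)n}: equality of the
   images under every representation of the presentation in a K-algebra
   (universal property of the algebra given by generators and relations). *)
Definition osp_eq (n : nat) (t s : term K (nat * gen)) : Prop :=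
  forall (R : algType K) (v : nat -> gen -> R),
    osp_rel n v -> teval (fun x => v x.1 x.2) t = teval (fun x => v x.1 x.2) s.

Definition Delta_gen (p : nat) (g : gen) : term K (nat * gen) :=
  match g with
  | GAp => tadd (tmul (ov p GAp) (tmul (ov p.+1 GK) (ov p.+1 GP)))
                (tmul (ov p GKi) (ov p.+1 GAp))
  | GAm => tadd (tmul (ov p GAm) (tmul (ov p.+1 GK) (ov p.+1 GP)))
                (tmul (ov p GKi) (ov p.+1 GAm))
  | GK => tmul (ov p GK) (ov p.+1 GK)
  | GKi => tmul (ov p GKi) (ov p.+1 GKi)
  | GP => tmul (ov p GP) (ov p.+1 GP)
  end.

Definition Delta (p : nat) (t : term K (nat * gen)) : term K (nat * gen) :=
  tsubst (fun x => if (x.1 < p)%N then ov x.1 x.2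
                   else if x.1 == p then Delta_gen p x.2
                   else ov x.1.+1 x.2) t.

Definition ir_emb (p : nat) (s : irgen) : term K (nat * gen) :=
  match s with
  | IRa => tmul (ov p GAp) (ov p GK)
  | IRb => tmul (ov p GAm) (ov p GK)
  | IRc => tmul (ov p GK) (tmul (ov p GK) (ov p GP))
  | IRg => Gamma_at (ov p)
  end.

Definition mterm := term K ((nat * gen) + irgen).
Definition mv (i : nat) (g : gen) : mterm := tvar (inl (i, g)).
Definition mi (s : irgen) : mterm := tvar (inr s).

(* tau_R(s): osp part at position p, I_R part symbolic (next position). *)
Definition tau_img (p : nat) (s : irgen) : mterm :=
  match s with
  | IRb => tmul (tmul (mv p GK) (tmul (mv p GK) (mv p GP))) (mi IRb)
  | IRa =>
      tadd (tmul (tmul (mv p GKi) (tmul (mv p GKi) (mv p GP))) (mi IRa))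
     (tadd (tmul (tconst (q12^-1 * qdiff))
                 (tmul (tmul (mv p GAp) (tmul (mv p GAp) (mv p GP))) (mi IRb)))
     (tadd (tmul (tconst (q12^-1 * (q12 - q12^-1)))
                 (tmul (tmul (mv p GAp) (tmul (mv p GKi) (mv p GP))) (mi IRc)))
           (tmul (tconst (q12^-1 * qdiff))
                 (tmul (tmul (mv p GAp) (tmul (mv p GKi) (mv p GP))) (mi IRg)))))
  | IRc => tadd (mi IRc)
                (tmul (tconst (- qdiff)) (tmul (tmul (mv p GAp) (mv p GK)) (mi IRb)))
  | IRg => mi IRg
  end.

Definition emb (p : nat) (x : (nat * gen) + irgen) : term K (nat * gen) :=
  match x with
  | inl y => ov y.1 y.2
  | inr s => ir_emb p s
  end.

(* 1^{(x)p} (x) tau_R, applied to an element of osp^{(x)p} (x) I_R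
   (a subalgebra of osp^{(x)(p+1)}): pick an expression of the element as a
   noncommutative polynomial in generators of osp^{(x)p} (x) 1 and
   1 (x) {A_+K, A_-K, K^2P, Gamma^q}, and apply the algebra morphism. *)
Definition tauR (p : nat) (t : term K (nat * gen)) : term K (nat * gen) :=
  let Q := epsilon (inhabits (tconst 0 : mterm))
    (fun Q : mterm =>
       tvars_ok (fun x => match x with inl y => (y.1 < p)%N | inr _ => true end) Q
       /\ osp_eq p.+1 (tsubst (emb p) Q) t) in
  tsubst (fun x => match x with
                   | inl y => ov y.1 y.2
                   | inr s => tsubst (emb p.+1) (tau_img p s)
                   end) Q.

Fixpoint taus (k start : nat) (t : term K (nat * gen)) : term K (nat * gen) :=
  match k with
  | 0 => t
  | k'.+1 => taus k' start.+1 (tauR start t)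
  end.

(* mu_i, with dp = a_{i-1} - a_1 and dc = a_i - a_1. *)
Definition mu (dp dc : nat) (t : term K (nat * gen)) : term K (nat * gen) :=
  taus (dc - dp - 1)%N dp.+1 (Delta dp t).

Fixpoint muall (dp : nat) (ds : seq nat) (t : term K (nat * gen)) :=
  match ds with
  | [::] => t
  | dc :: ds' => muall dc ds' (mu dp dc t)
  end.

(* Gamma^q_A for A given by its sorted list of (0-based) positions;
   c0 is the scalar Gamma^q_emptyset. *)
Definition GammaSeq (c0 : K) (s : seq nat) : term K (nat * gen) :=
  match s with
  | [::] => tconst c0
  | a1 :: rest =>
      tsubst (fun x => ov (x.1 + a1)%N x.2)
             (muall 0 [seq (a - a1)%N | a <- rest] (Gamma_at (ov 0)))
  end.

(* A subset of [1;n] is encoded as a set of 'I_n (element i <-> i+1). *)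
Definition GammaSet (n : nat) (c0 : K) (A : {set 'I_n}) : term K (nat * gen) :=
  GammaSeq c0 (sort leq [seq val i | i <- enum A]).

End Osp.

(* Main.v *)
Require Import Defs.
From HB Require Import structures.
From mathcomp Require Import all_boot all_order all_algebra ring.
From Stdlib Require Import ClassicalEpsilon.
Import GRing.Theory.
Local Open Scope ring_scope.
Set Implicit Arguments. Unset Strict Implicit. Unset Printing Implicit Defensive.

(** The coaction [tau_R] is, up to a Cartan twist, conjugation by the
   q-exponential [F] of [X = A_+K (x) A_-K^-1P]. The series [F] is infinite, but
   multiplying the generator [A_+] of the left factor by a nilpotent central [h] makes it
   finite; identities that are polynomial in [h] hold at [h = 1] once they hold
   for nilpotent [h] of every order. Conjugation extends [tau_R] to the whole of
   osp_q(1|2), which gives both its well-definedness on I_R and the following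
   description of Gamma_A. Fold over the positions from right to left, starting from
   the counit: a position of A acts by the coproduct, the others by conjugation with [F].
   The result is a representation [w_A] of osp_q(1|2), and Gamma_A is the Casimir of [w_A].
   For B inside A, the generators of I_R that produce Gamma_B satisfy the
   commutation rules of the adjoint action with respect to [w_A] ([adrel]), and
   these rules are stable under all the steps of the fold. In particular
   Gamma_B commutes with [w_A], hence with Gamma_A. *)

(** * Normal forms of noncommutative polynomials *)

(* ((z, (e, d)), w) stands for z s^e (q - q^-1)^-d times the word w. *)
Definition mono := (int * (int * nat) * seq nat)%type.
Definition mono_mul (m1 m2 : mono) : mono :=
  (m1.1.1 * m2.1.1, (m1.1.2.1 + m2.1.2.1, (m1.1.2.2 + m2.1.2.2)%N), m1.2 ++ m2.2).
Definition ncmul (p1 p2 : seq mono) : seq mono :=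
  [seq mono_mul m1 m2 | m1 <- p1, m2 <- p2].
Definition ncopp (p : seq mono) : seq mono :=
  [seq (- m.1.1, m.1.2, m.2) | m <- p].

Fixpoint ncinsert (m : mono) (p : seq mono) : seq mono :=
  match p with
  | [::] => [:: m]
  | m' :: p' => if (m'.1.2 == m.1.2) && (m'.2 == m.2)
                then (m'.1.1 + m.1.1, m.1.2, m.2) :: p'
                else m' :: ncinsert m p'
  end.

(** The factor is (s^2 - s^-2) (q - q^-1)^-1 = 1: the value is kept while the exponent of the
    denominator grows by one, so that like terms can be collected over a common denominator. *)
Definition nclift1 (p : seq mono) : seq mono :=
  ncmul [:: (1, (2, 1%N), [::]); (-1, (-2, 1%N), [::])] p.

Definition nclift (d : nat) (m : mono) : seq mono :=
  iter (d - m.1.2.2) nclift1 [:: m].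

Definition nczero (d : nat) (p : seq mono) : bool :=
  all (fun m : mono => m.1.1 == 0) (foldr ncinsert [::] (flatten (map (nclift d) p))).

Definition ncrule := (nat * nat * seq mono)%type.

Fixpoint lookup (rs : seq ncrule) (i j : nat) : option (seq mono) :=
  match rs with
  | [::] => None
  | r :: rs' => if (r.1.1 == i) && (r.1.2 == j) then Some r.2 else lookup rs' i j
  end.

Fixpoint reduce1 (rs : seq ncrule) (w : seq nat) : option (seq mono) :=
  match w with
  | i :: w1 =>
    match w1 with
    | j :: w2 =>
      match lookup rs i j with
      | Some p => Some (ncmul p [:: (1, (0, 0%N), w2)])
      | None => match reduce1 rs w1 with
                | Some p => Some (ncmul [:: (1, (0, 0%N), [:: i])] p)
                | None => None
                end
      end
    | [::] => None
    end
  | [::] => None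
  end.

(** Running out of fuel leaves the remaining terms unreduced, which keeps the value; soundness thus
    needs neither termination nor confluence of the rules. *)
Fixpoint ncnorm (rs : seq ncrule) (fuel : nat) (p : seq mono) : seq mono :=
  match fuel with
  | 0 => p
  | fuel'.+1 =>
    match p with
    | [::] => [::]
    | m :: p' => match reduce1 rs m.2 with
                 | Some p1 => ncnorm rs fuel' (ncmul [:: (m.1, [::])] p1 ++ p')
                 | None => m :: ncnorm rs fuel' p'
                 end
    end
  end.

Inductive cexp := C1 | Cs | Csi | CD | Cadd of cexp & cexp | Cmul of cexp & cexp
  | Copp of cexp | Cqd | Ce.
Inductive aexp := Avar of nat | A0 | A1 | Aadd of aexp & aexp | Aopp of aexp
  | Amul of aexp & aexp | Ascale of cexp & aexp.

(** The case [Ce] rests on s^2 - s^-2 = (s - s^-1)(s + s^-1), which turns (s - s^-1)^-1 into (s +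
    s^-1)(q - q^-1)^-1. *)
Fixpoint cnc (c : cexp) : seq mono :=
  match c with
  | C1 => [:: (1, (0, 0%N), [::])]
  | Cs => [:: (1, (1, 0%N), [::])]
  | Csi => [:: (1, (-1, 0%N), [::])]
  | CD => [:: (1, (0, 1%N), [::])]
  | Cadd a b => cnc a ++ cnc b
  | Cmul a b => ncmul (cnc a) (cnc b)
  | Copp a => ncopp (cnc a)
  | Cqd => [:: (1, (2, 0%N), [::]); (-1, (-2, 0%N), [::])]
  | Ce => [:: (1, (1, 1%N), [::]); (1, (-1, 1%N), [::])]
  end.

Fixpoint anc (a : aexp) : seq mono :=
  match a with
  | Avar i => [:: (1, (0, 0%N), [:: i])]
  | A0 => [::]
  | A1 => [:: (1, (0, 0%N), [::])]
  | Aadd a b => anc a ++ anc b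
  | Aopp a => ncopp (anc a)
  | Amul a b => ncmul (anc a) (anc b)
  | Ascale c a => ncmul (cnc c) (anc a)
  end.

(** * Soundness of the normalisation *)

Section Sound.
Variables (K : fieldType) (s : K) (hs : s != 0) (hd : qdiff s != 0).
Variables (R : algType K) (env : nat -> R).

Definition mcoef (m : mono) : K := m.1.1%:~R * (s ^ m.1.2.1) * (qdiff s)^-1 ^+ m.1.2.2.
Definition meval (m : mono) : R := mcoef m *: \prod_(i <- m.2) env i.
Definition nceval (p : seq mono) : R := \sum_(m <- p) meval m.

Fixpoint ceval (c : cexp) : K :=
  match c with
  | C1 => 1
  | Cs => s
  | Csi => s^-1
  | CD => (qdiff s)^-1
  | Cadd a b => ceval a + ceval b
  | Cmul a b => ceval a * ceval b
  | Copp a => - ceval a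
  | Cqd => qdiff s
  | Ce => (s - s^-1)^-1
  end.

Fixpoint aeval (a : aexp) : R :=
  match a with
  | Avar i => env i
  | A0 => 0
  | A1 => 1
  | Aadd a b => aeval a + aeval b
  | Aopp a => - aeval a
  | Amul a b => aeval a * aeval b
  | Ascale c a => ceval c *: aeval a
  end.

Lemma meval_mul m1 m2 : meval (mono_mul m1 m2) = meval m1 * meval m2.
Proof.
rewrite /meval /= big_cat /= -scalerAl -scalerAr scalerA; congr (_ *: _).
rewrite /mcoef /= intrM expfzDr // exprD.
by rewrite -!mulrA; congr (_ * _); rewrite mulrCA; congr (_ * _); rewrite !mulrA; congr (_ * _);
  rewrite mulrC !mulrA.
Qed.

Lemma nceval_cat p1 p2 : nceval (p1 ++ p2) = nceval p1 + nceval p2.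
Proof. exact: big_cat. Qed.

Lemma nceval_mul p1 p2 : nceval (ncmul p1 p2) = nceval p1 * nceval p2.
Proof.
rewrite /nceval /ncmul big_allpairs_dep /= mulr_suml; apply: eq_bigr => m1 _.
by rewrite mulr_sumr; apply: eq_bigr => m2 _; rewrite meval_mul.
Qed.

Lemma nceval_opp p : nceval (ncopp p) = - nceval p.
Proof.
rewrite /nceval big_map -sumrN; apply: eq_bigr => m _.
by rewrite /meval /mcoef /= mulrNz !mulNr scaleNr.
Qed.

Lemma nceval_seq1 m : nceval [:: m] = meval m.
Proof. exact: big_seq1. Qed.

Lemma nceval_insert m p : nceval (ncinsert m p) = meval m + nceval p.
Proof.
elim: p => [|m' p IHp] /=; first by rewrite nceval_seq1 /nceval big_nil addr0.
rewrite /nceval; case: ifP => [/andP[/eqP e1 /eqP e2]|_]; rewrite !big_cons.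
  rewrite addrA; congr (_ + _); rewrite /meval /mcoef /= e1 e2 -scalerDl; congr (_ *: _).
  by rewrite intrD !mulrDl addrC.
by rewrite addrCA -/(nceval _) IHp.
Qed.

Lemma nceval_lift1 p : nceval (nclift1 p) = nceval p.
Proof.
rewrite nceval_mul -[RHS]mul1r; congr (_ * _).
rewrite /nceval big_cons big_seq1 /meval /mcoef /= !big_nil -scalerDl.
have -> : 1%:~R * s ^ 2 * (qdiff s)^-1 ^+ 1 + (-1)%:~R * s ^ (-2) * (qdiff s)^-1 ^+ 1 = 1 :> K.
  by rewrite -mulrDl !expr1 mulN1r mul1r; apply: mulfV.
by rewrite scale1r.
Qed.

Lemma nceval_flatten_lift d p : nceval (flatten (map (nclift d) p)) = nceval p.
Proof.
elim: p => [|m p IHp] //=; rewrite nceval_cat IHp [RHS]/nceval big_cons; congr (_ + _).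
by rewrite /nclift; elim: (_ - _)%N => [|k IHk] /=; rewrite ?nceval_seq1 // nceval_lift1.
Qed.

Lemma nczeroP d p : nczero d p -> nceval p = 0.
Proof.
rewrite /nczero -[nceval p](nceval_flatten_lift d).
have -> : forall p', nceval p' = nceval (foldr ncinsert [::] p').
  by elim=> [|m p' IHp] //=; rewrite nceval_insert -IHp [LHS]/nceval big_cons.
move=> /allP h; rewrite /nceval big_seq big1 // => m /h /eqP m0.
by rewrite /meval /mcoef m0 !mul0r scale0r.
Qed.

Fixpoint rules_ok (rs : seq ncrule) : Prop :=
  match rs with
  | [::] => True
  | r :: rs' => env r.1.1 * env r.1.2 = nceval r.2 /\ rules_ok rs'
  end.

Variables (rs : seq ncrule) (hrs : rules_ok rs).

Lemma lookupP i j p : lookup rs i j = Some p -> env i * env j = nceval p.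
Proof.
elim: rs hrs => [|r rs' IHrs] //= [h1 h2].
by case: ifP => [/andP[/eqP <- /eqP <-] [<-] //|_]; apply: IHrs.
Qed.

Lemma meval_word w : meval (1, (0, 0%N), w) = \prod_(i <- w) env i.
Proof. by rewrite /meval /mcoef /= expr0z expr0 !mulr1 scale1r. Qed.

Lemma reduce1P w p : reduce1 rs w = Some p -> \prod_(i <- w) env i = nceval p.
Proof.
elim: w p => [|i w IHw] p //=; case: w IHw => [|j w] // IHw.
case e: (lookup rs i j) => [p1|].
  by case=> <-; rewrite nceval_mul nceval_seq1 meval_word !big_cons mulrA (lookupP e).
case e1: (reduce1 rs (j :: w)) => [p1|] // [<-].
by rewrite nceval_mul nceval_seq1 meval_word big_seq1 big_cons (IHw _ e1).
Qed.

Lemma nceval_norm fuel p : nceval (ncnorm rs fuel p) = nceval p.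
Proof.
elim: fuel p => [|fuel IHf] [|m p] //=.
case e: (reduce1 rs m.2) => [p1|]; last by rewrite /nceval !big_cons -/(nceval _) IHf.
rewrite IHf nceval_cat nceval_mul nceval_seq1 [RHS]/nceval big_cons; congr (_ + _).
by rewrite -(reduce1P e) /meval /mcoef /= big_nil -scalerAl mul1r.
Qed.

Lemma cncP c : nceval (cnc c) = (ceval c)%:A.
Proof.
elim: c => [||||a IHa b IHb|a IHa b IHb|a IHa||] /=.
- by rewrite nceval_seq1 meval_word big_nil scale1r.
- by rewrite nceval_seq1 /meval /mcoef /= big_nil expr0 expr1z mulr1 mul1r.
- by rewrite nceval_seq1 /meval /mcoef /= big_nil expr0 mulr1 mul1r.
- by rewrite nceval_seq1 /meval /mcoef /= big_nil expr0z expr1 !mul1r.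
- by rewrite nceval_cat IHa IHb scalerDl.
- by rewrite nceval_mul IHa IHb -scalerAl mul1r scalerA.
- by rewrite nceval_opp IHa scaleNr.
- rewrite /nceval big_cons big_seq1 /meval /mcoef /= !big_nil -scalerDl; congr (_ *: _).
  by rewrite !expr0 !mulr1 mul1r mulN1r.
- rewrite /nceval big_cons big_seq1 /meval /mcoef /= !big_nil -scalerDl; congr (_ *: _).
  have e : qdiff s = (s - s^-1) * (s + s^-1).
    by rewrite -subr_sqr exprVn.
  move: hd; rewrite !mul1r !expr1 expr1z -[s ^ (-1)]/(s^-1) e mulf_eq0 negb_or => /andP[h1 h2].
  by rewrite -mulrDl invfM mulrC -mulrA mulVf ?mulr1.
Qed.

Lemma ancP a : nceval (anc a) = aeval a.
Proof.
elim: a => [i|||a IHa b IHb|a IHa|a IHa b IHb|c a IHa] /=.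
- by rewrite nceval_seq1 meval_word big_seq1.
- by rewrite /nceval big_nil.
- by rewrite nceval_seq1 meval_word big_nil.
- by rewrite nceval_cat IHa IHb.
- by rewrite nceval_opp IHa.
- by rewrite nceval_mul IHa IHb.
- by rewrite nceval_mul IHa cncP -scalerAl mul1r.
Qed.

End Sound.

Definition arule := (nat * nat * aexp)%type.
Definition ncrules : seq arule -> seq ncrule := map (fun r => (r.1, anc r.2)).

Fixpoint arules_ok (K : fieldType) (s : K) (R : algType K) (env : nat -> R)
    (rs : seq arule) : Prop :=
  match rs with
  | [::] => True
  | r :: rs' => env r.1.1 * env r.1.2 = aeval s env r.2 /\ arules_ok s env rs'
  end.

Section Solve.
Variables (K : fieldType) (s : K) (hs : s != 0) (hd : qdiff s != 0).
Variables (R : algType K) (env : nat -> R).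

Lemma arules_ok_cat rs1 rs2 :
  arules_ok s env rs1 -> arules_ok s env rs2 -> arules_ok s env (rs1 ++ rs2).
Proof. by elim: rs1 => [|r rs1 IHrs] //= [h1 h2] h; split=> //; apply: IHrs. Qed.

(** Proof by reflection. The 4 is the common exponent of the denominators and the product is the
    fuel; the argument is sound for any choice of the two. *)
Lemma ncsolve rs a b : arules_ok s env rs ->
  nczero 4 (ncnorm (ncrules rs) (100 * 100) (anc (Aadd a (Aopp b)))) ->
  aeval s env a = aeval s env b.
Proof.
move=> hrs /(nczeroP hs hd env).
have hrs' : rules_ok s env (ncrules rs).
  by elim: rs hrs => [|r rs IHrs] //= [h1 h2]; split; [rewrite h1 ancP | apply: IHrs].
by rewrite (nceval_norm hs hrs') ancP //= => /eqP; rewrite subr_eq0 => /eqP.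
Qed.
End Solve.

(** * Reification of goals *)

Ltac reify_coef s c :=
  lazymatch c with
  | s => constr:(Cs)
  | GRing.inv s => constr:(Csi)
  | GRing.inv (qdiff s) => constr:(CD)
  | GRing.inv (GRing.add s (GRing.opp (GRing.inv s))) => constr:(Ce)
  | qdiff s => constr:(Cqd)
  | GRing.one _ => constr:(C1)
  | GRing.add ?a ?b =>
      let a := reify_coef s a in let b := reify_coef s b in constr:(Cadd a b)
  | GRing.mul ?a ?b =>
      let a := reify_coef s a in let b := reify_coef s b in constr:(Cmul a b)
  | GRing.opp ?a => let a := reify_coef s a in constr:(Copp a)
  end.

(** The numbering is that of [lenv]. The last case is meant for 0: a subterm not convertible to 0
    makes the [refine] of [nc] fail. *)
Ltac reify_alg s u I w t :=
  lazymatch t with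
  | u GAp => constr:(Avar 0) | u GAm => constr:(Avar 1) | u GK => constr:(Avar 2)
  | u GKi => constr:(Avar 3) | u GP => constr:(Avar 4)
  | I IRa => constr:(Avar 5) | I IRb => constr:(Avar 6)
  | I IRc => constr:(Avar 7) | I IRg => constr:(Avar 8)
  | w GAp => constr:(Avar 9) | w GAm => constr:(Avar 10) | w GK => constr:(Avar 11)
  | w GKi => constr:(Avar 12) | w GP => constr:(Avar 13)
  | GRing.one _ => constr:(A1)
  | GRing.add ?a ?b =>
      let a := reify_alg s u I w a in let b := reify_alg s u I w b in constr:(Aadd a b)
  | GRing.mul ?a ?b =>
      let a := reify_alg s u I w a in let b := reify_alg s u I w b in constr:(Amul a b)
  | GRing.opp ?a => let a := reify_alg s u I w a in constr:(Aopp a)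
  | GRing.scale ?c ?a =>
      let c := reify_coef s c in let a := reify_alg s u I w a in constr:(Ascale c a)
  | _ => constr:(A0)
  end.

Definition lenv (R : Type) (u : gen -> R) (I : irgen -> R) (w : gen -> R) (n : nat) : R :=
  match n with
  | 0 => u GAp | 1 => u GAm | 2 => u GK | 3 => u GKi | 4 => u GP
  | 5 => I IRa | 6 => I IRb | 7 => I IRc | 8 => I IRg
  | 9 => w GAp | 10 => w GAm | 11 => w GK | 12 => w GKi | _ => w GP
  end.

Ltac nc hs hd hrs s u I w :=
  lazymatch goal with
  | |- @eq ?R ?a ?b =>
    let ea := reify_alg s u I w a in
    let eb := reify_alg s u I w b in
    refine (@ncsolve _ s hs hd _ (lenv u I w) _ ea eb hrs _); vm_compute; reflexivity
  end.

(** * Relations of osp_q(1|2) and of I_R *)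

Definition gcode (g : gen) : nat :=
  match g with GAp => 0 | GAm => 1 | GK => 2 | GKi => 3 | GP => 4 end.

Definition borel_arules (o : nat) : seq arule :=
  let A := Avar o in let K := Avar (o + 2) in let Ki := Avar (o + 3) in
  let P := Avar (o + 4) in
  [:: ((o + 2, o)%N, Ascale Cs (Amul A K)); ((o + 3, o)%N, Ascale Csi (Amul A Ki));
      ((o + 4, o)%N, Aopp (Amul A P)); ((o + 4, o + 2)%N, Amul K P);
      ((o + 4, o + 3)%N, Amul Ki P); ((o + 2, o + 3)%N, A1); ((o + 3, o + 2)%N, A1);
      ((o + 4, o + 4)%N, A1)].

(** Oriented towards the PBW words A_+^a A_-^b K^c P^e, with c an integer and e at most 1; [o] is
    the number of the letter A_+. *)
Definition osp_arules (o : nat) : seq arule :=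
  let Ap := Avar o in let Am := Avar (o + 1) in
  let K := Avar (o + 2) in let Ki := Avar (o + 3) in let P := Avar (o + 4) in
  [:: ((o + 1, o)%N, Aadd (Ascale Ce (Aadd (Amul K K) (Aopp (Amul Ki Ki)))) (Aopp (Amul Ap Am)));
      ((o + 2, o + 1)%N, Ascale Csi (Amul Am K)); ((o + 3, o + 1)%N, Ascale Cs (Amul Am Ki));
      ((o + 4, o + 1)%N, Aopp (Amul Am P))] ++ borel_arules o.

Definition swap_arules (ls1 ls2 : seq nat) : seq arule :=
  [seq ((i, j), Amul (Avar j) (Avar i)) | i <- ls1, j <- ls2].

Definition ulet : seq nat := iota 0 5.
Definition ilet : seq nat := iota 5 4.
Definition wlet : seq nat := iota 9 5.

(** The rules of [adrel], oriented so that the letters of w move to the right of those of I.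
    Together with the swaps, words get sorted as u, I, w. The rules for K^-1 follow from those for
    K. *)
Definition act_arules : seq arule :=
  let a := Avar 5 in let b := Avar 6 in let c := Avar 7 in let g := Avar 8 in
  let Bp := Avar 9 in let Bm := Avar 10 in let L := Avar 11 in let Li := Avar 12 in
  let Q := Avar 13 in
  let z := Amul (Aadd c (Ascale (Cadd Cs Csi) g)) (Amul L Q) in
  [:: ((9, 5)%N, Ascale Csi (Amul a Bp));
      ((9, 6)%N, Aadd (Ascale Cs (Amul b Bp)) (Aopp (Ascale Cs z)));
      ((9, 7)%N, Aadd (Amul c Bp) (Ascale (Cadd C1 (Cmul Cs Cs)) (Amul a (Amul L Q))));
      ((10, 5)%N, Aadd (Ascale Csi (Amul a Bm)) (Ascale Csi z));
      ((10, 6)%N, Ascale Cs (Amul b Bm));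
      ((10, 7)%N, Aadd (Amul c Bm) (Ascale (Cadd C1 (Cmul Csi Csi)) (Amul b (Amul L Q))));
      ((11, 5)%N, Ascale Cs (Amul a L)); ((11, 6)%N, Ascale Csi (Amul b L));
      ((11, 7)%N, Amul c L);
      ((12, 5)%N, Ascale Csi (Amul a Li)); ((12, 6)%N, Ascale Cs (Amul b Li));
      ((12, 7)%N, Amul c Li);
      ((13, 5)%N, Aopp (Amul a Q)); ((13, 6)%N, Aopp (Amul b Q)); ((13, 7)%N, Amul c Q)]
  ++ swap_arules wlet [:: 8%N].

Section Osp.
Variables (K : fieldType) (s : K).

Section Rel.
Variable R : algType K.
Implicit Types (u w : gen -> R) (I : irgen -> R).

Definition osp1 u : Prop :=
  (u GK * u GAp * u GKi = s *: u GAp) /\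
  (u GK * u GAm * u GKi = s^-1 *: u GAm) /\
  (u GAp * u GAm + u GAm * u GAp
     = (s - s^-1)^-1 *: (u GK * u GK - u GKi * u GKi)) /\
  (u GP * u GAp + u GAp * u GP = 0) /\
  (u GP * u GAm + u GAm * u GP = 0) /\
  (u GP * u GK = u GK * u GP) /\
  (u GP * u GKi = u GKi * u GP) /\
  (u GK * u GKi = 1) /\
  (u GKi * u GK = 1) /\
  (u GP * u GP = 1).

(** These relations are homogeneous in A_+, hence survive multiplication of A_+ by a central h; the
    one relating A_+ and A_- to K does not. *)
Definition borel u : Prop :=
  (u GK * u GAp * u GKi = s *: u GAp) /\
  (u GP * u GAp + u GAp * u GP = 0) /\
  (u GP * u GK = u GK * u GP) /\
  (u GP * u GKi = u GKi * u GP) /\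
  (u GK * u GKi = 1) /\
  (u GKi * u GK = 1) /\
  (u GP * u GP = 1).

(* The adjoint action preserves the span of A_+K, A_-K, K^2P, Gamma; these are the
   resulting commutation rules of [w] with the four generators. *)
Definition adrel w I : Prop :=
  let z := (I IRc + (s + s^-1) *: I IRg) * (w GK * w GP) in
  (w GAp * I IRa = s^-1 *: (I IRa * w GAp)) /\
  (w GAp * I IRb = s *: (I IRb * w GAp) - s *: z) /\
  (w GAp * I IRc = I IRc * w GAp + (1 + s * s) *: (I IRa * (w GK * w GP))) /\
  (w GAm * I IRa = s^-1 *: (I IRa * w GAm) + s^-1 *: z) /\
  (w GAm * I IRb = s *: (I IRb * w GAm)) /\
  (w GAm * I IRc = I IRc * w GAm + (1 + s^-1 * s^-1) *: (I IRb * (w GK * w GP))) /\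
  (w GK * I IRa = s *: (I IRa * w GK)) /\
  (w GK * I IRb = s^-1 *: (I IRb * w GK)) /\
  (w GK * I IRc = I IRc * w GK) /\
  (w GP * I IRa = - (I IRa * w GP)) /\
  (w GP * I IRb = - (I IRb * w GP)) /\
  (w GP * I IRc = I IRc * w GP) /\
  (forall g, w g * I IRg = I IRg * w g).

Definition commf (A B : Type) (f : A -> R) (g : B -> R) : Prop :=
  forall x y, f x * g y = g y * f x.

Hypothesis hs : s != 0.

Lemma borel_of_osp1 u : osp1 u -> borel u.
Proof. by case=> h1 [h2 [h3 [h4 [h5 [h6 [h7 [h8 [h9 h10]]]]]]]]; do !split. Qed.

Lemma kcomm (k ki x : R) c : c != 0 -> k * ki = 1 -> ki * k = 1 ->
  k * x * ki = c *: x -> k * x = c *: (x * k) /\ ki * x = c^-1 *: (x * ki).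
Proof.
move=> hc h1 h2 h.
have e : k * x = c *: (x * k) by rewrite scalerAl -h -[RHS]mulrA h2 mulr1.
split=> //.
rewrite -[in LHS](mulr1 x) -h1 !mulrA -[_ * x * k]mulrA.
rewrite -(scalerK hc (x * k)) -e -scalerAr -scalerAl; congr (_ *: _).
by rewrite !mulrA h2 mul1r.
Qed.

Lemma borel_arulesP (env : nat -> R) o :
  borel (fun g => env (o + gcode g)%N) -> arules_ok s env (borel_arules o).
Proof.
rewrite /borel /= !addn0 => -[h1 [h2 [h3 [h4 [h5 [h6 h7]]]]]].
have [e1 e2] := kcomm hs h5 h6 h1.
do !split=> //=.
by apply/eqP; rewrite -addr_eq0 h2.
Qed.

Lemma osp_arulesP (env : nat -> R) o :
  osp1 (fun g => env (o + gcode g)%N) -> arules_ok s env (osp_arules o).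
Proof.
move=> hu; apply: arules_ok_cat; last exact/borel_arulesP/borel_of_osp1.
move: hu; rewrite /osp1 /= !addn0 => -[h1 [h2 [h3 [h4 [h5 [h6 [h7 [h8 [h9 h10]]]]]]]]].
have [e1 e2] := kcomm (invr_neq0 hs) h8 h9 h2; rewrite invrK in e2.
do !split=> //=.
  by rewrite -h3 [X in X - _]addrC addrK.
by apply/eqP; rewrite -addr_eq0 h5.
Qed.

Lemma swap_arulesP (env : nat -> R) (ls1 ls2 : seq nat) :
  (forall i j, i \in ls1 -> j \in ls2 -> env i * env j = env j * env i) ->
  arules_ok s env (swap_arules ls1 ls2).
Proof.
move=> h; rewrite /swap_arules.
elim: ls1 h => [|i ls1 IHl] h //=; apply: arules_ok_cat; last first.
  by apply: IHl => i' j hi hj; apply: h; rewrite // inE hi orbT.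
have {}h j : j \in ls2 -> env i * env j = env j * env i by move=> hj; apply: h; rewrite ?mem_head.
elim: ls2 h {IHl} => [|j ls2 IHl] h //=; split; first by rewrite h ?mem_head.
by apply: IHl => j' hj; apply: h; rewrite inE hj orbT.
Qed.

Lemma act_arulesP u I w : osp1 w -> adrel w I -> arules_ok s (lenv u I w) act_arules.
Proof.
case=> _ [_ [_ [_ [_ [_ [_ [k1 [k2 _]]]]]]]].
case=> h1 [h2 [h3 [h4 [h5 [h6 [h7 [h8 [h9 [h10 [h11 [h12 h13]]]]]]]]]]].
apply: arules_ok_cat; last first.
  apply: swap_arulesP => i j hi; rewrite inE => /eqP->; move: hi.
  by rewrite !inE => /or4P[/eqP->|/eqP->|/eqP->|/orP[]/eqP->] /=; rewrite h13.
have kk (x : R) c : c != 0 -> w GK * x = c *: (x * w GK) -> w GKi * x = c^-1 *: (x * w GKi).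
  move=> hc h; apply: (kcomm hc k1 k2 _).2.
  by rewrite h -scalerAl -mulrA k1 mulr1.
have e7 := kk _ _ hs h7.
have e8 := kk _ _ (invr_neq0 hs) h8; rewrite invrK in e8.
have e9 := kk (I IRc) 1 (oner_neq0 K); rewrite invr1 !scale1r in e9.
by do !split=> //=; apply: e9.
Qed.

Lemma commf_swap12 u I w : commf u I ->
  arules_ok s (lenv u I w) (swap_arules ilet ulet).
Proof.
move=> h; apply: swap_arulesP => i j; rewrite !inE.
by move=> /or4P[]/eqP-> /or4P[/eqP->|/eqP->|/eqP->|/orP[]/eqP->]; rewrite /= h.
Qed.

Lemma commf_swap13 u I w : commf u w ->
  arules_ok s (lenv u I w) (swap_arules wlet ulet).
Proof.
move=> h; apply: swap_arulesP => i j; rewrite !inE.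
by move=> /or4P[/eqP->|/eqP->|/eqP->|/orP[]/eqP->] /or4P[/eqP->|/eqP->|/eqP->|/orP[]/eqP->];
  rewrite /= h.
Qed.

End Rel.

(** * One step of the fold, by the coproduct or by tau_R *)

Section Steps.
Variable R : algType K.
Implicit Types (u w : gen -> R) (I : irgen -> R).

Definition irof u (i : irgen) : R := teval (fun x => u x.2) (ir_emb s 0 i).

Definition menv u I (x : (nat * gen) + irgen) : R :=
  match x with inl y => u y.2 | inr i => I i end.

(** The tensor product of the representations u and w, once their images commute. *)
Definition tens u w (g : gen) : R :=
  teval (fun x => if x.1 == 0%N then u x.2 else w x.2) (Delta_gen K 0 g).

(* [Delta] on I_R, which is a left coideal, with the I_R part symbolic as in [tau_img]. *)
Definition delta_img (p : nat) (i : irgen) : mterm K :=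
  match i with
  | IRa => tadd (tmul (tmul (mv K p GAp) (mv K p GK)) (mi K IRc)) (mi K IRa)
  | IRb => tadd (tmul (tmul (mv K p GAm) (mv K p GK)) (mi K IRc)) (mi K IRb)
  | IRc => tmul (tmul (mv K p GK) (tmul (mv K p GK) (mv K p GP))) (mi K IRc)
  | IRg =>
      tadd (tmul (tmul (tadd (tmul (tconst (qdiff s)^-1)
               (tmul (tconst s^-1) (tadd (tmul (mv K p GK) (mv K p GK))
                  (tmul (tconst (-1)) (tmul (mv K p GKi) (mv K p GKi))))))
              (tmul (tconst (-1)) (tmul (mv K p GAp) (mv K p GAm)))) (mv K p GP)) (mi K IRc))
     (tadd (tmul (tconst s^-1) (tmul (tmul (mv K p GAp) (tmul (mv K p GKi) (mv K p GP))) (mi K IRb)))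
     (tadd (tmul (tconst (-1)) (tmul (tmul (mv K p GKi) (tmul (mv K p GAm) (mv K p GP))) (mi K IRa)))
           (tmul (tmul (mv K p GKi) (tmul (mv K p GKi) (mv K p GP))) (mi K IRg))))
  end.

Definition irdelta u I (i : irgen) : R := teval (menv u I) (delta_img 0 i).
Definition irtau u I (i : irgen) : R := teval (menv u I) (tau_img s 0 i).

Hypotheses (hs : s != 0) (hd : qdiff s != 0).

Definition all_rules : seq arule :=
  osp_arules 0 ++ osp_arules 9 ++ act_arules ++ swap_arules ilet ulet ++ swap_arules wlet ulet.

Lemma osp_arules0 u I w : osp1 u -> arules_ok s (lenv u I w) (osp_arules 0).
Proof. by move=> h; apply: osp_arulesP. Qed.
Lemma osp_arules9 u I w : osp1 w -> arules_ok s (lenv u I w) (osp_arules 9).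
Proof. by move=> h; apply: osp_arulesP. Qed.

Definition tens_rules : seq arule :=
  osp_arules 0 ++ osp_arules 9 ++ swap_arules wlet ulet.

Ltac nctens hr u I w :=
  rewrite /osp1 /adrel /irof /irdelta /irtau /tens /=; do ?split; nc hs hd hr s u I w.

Lemma tens_osp u w : osp1 u -> osp1 w -> commf u w -> osp1 (tens u w).
Proof.
(* [lenv] needs a value for every letter; no letter of I occurs here, so any value does, and its
   body is cleared to keep it opaque. *)
move=> hu hw huw; pose I (i : irgen) : R := 0.
have hr : arules_ok s (lenv u I w) tens_rules.
  apply: arules_ok_cat (osp_arules0 _ _ hu) _.
  exact: arules_ok_cat (osp_arules9 _ _ hw) (commf_swap13 _ huw).
clearbody I.
nctens hr u I w.
Qed.

Lemma irof_tens u w : osp1 u -> osp1 w -> commf u w -> irof (tens u w) =1 irdelta u (irof w).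
Proof.
move=> hu hw huw; pose I (i : irgen) : R := 0.
have hr : arules_ok s (lenv u I w) tens_rules.
  apply: arules_ok_cat (osp_arules0 _ _ hu) _.
  exact: arules_ok_cat (osp_arules9 _ _ hw) (commf_swap13 _ huw).
clearbody I.
case; nctens hr u I w.
Qed.

Lemma all_rulesP u I w : osp1 u -> osp1 w -> commf u w -> commf u I -> adrel w I ->
  arules_ok s (lenv u I w) all_rules.
Proof.
move=> hu hw huw hui hwi; apply: arules_ok_cat; first exact: osp_arules0.
apply: arules_ok_cat; first exact: osp_arules9.
apply: arules_ok_cat; first exact: act_arulesP.
by apply: arules_ok_cat; [exact: commf_swap12 | exact: commf_swap13].
Qed.

(** The step at a position of both A and B. *)
Lemma adrel_tens_delta u I w : osp1 u -> osp1 w -> commf u w -> commf u I -> adrel w I ->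
  adrel (tens u w) (irdelta u I).
Proof.
move=> hu hw huw hui hwi; have hr := all_rulesP hu hw huw hui hwi.
rewrite /adrel /irdelta /irtau /tens /=; do ?split; last case=> /=; nc hs hd hr s u I w.
Qed.

(** The step at a position of A outside B. *)
Lemma adrel_tens_tau u I w : osp1 u -> osp1 w -> commf u w -> commf u I -> adrel w I ->
  adrel (tens u w) (irtau u I).
Proof.
move=> hu hw huw hui hwi; have hr := all_rulesP hu hw huw hui hwi.
rewrite /adrel /irdelta /irtau /tens /=; do ?split; last case=> /=; nc hs hd hr s u I w.
Qed.

Lemma adrel_irof w : osp1 w -> adrel w (irof w).
Proof.
move=> hw; pose I (i : irgen) : R := 0.
have hr : arules_ok s (lenv w I w) (osp_arules 0) by apply: osp_arules0.
clearbody I.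
rewrite /adrel /irof /=; do ?split; last case=> /=; nc hs hd hr s w I w.
Qed.

Lemma adrel_ext w I I' : I =1 I' -> adrel w I -> adrel w I'.
Proof.
rewrite /adrel => h; rewrite !h => h'.
by do ?[split; try by apply h'] => g; rewrite -h; apply h'.
Qed.

(** The Cartan twist. On I_R it is what remains of tau_R when A_+ is set to 0 in the left factor;
    [itwist] records this on the four generators. *)
Definition twist u w (g : gen) : R :=
  match g with
  | GAp => u GKi * u GKi * u GP * w GAp
  | GAm => u GK * u GK * u GP * w GAm
  | _ => w g
  end.

Definition itwist u I (i : irgen) : R :=
  match i with
  | IRa => u GKi * u GKi * u GP * I IRa
  | IRb => u GK * u GK * u GP * I IRb
  | _ => I i
  end.

Definition hole_rules : seq arule :=
  borel_arules 0 ++ osp_arules 9 ++ swap_arules wlet ulet.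

Lemma hole_rulesP u I w : borel u -> osp1 w -> commf u w ->
  arules_ok s (lenv u I w) hole_rules.
Proof.
move=> hu hw huw; apply: arules_ok_cat; first exact: borel_arulesP.
by apply: arules_ok_cat; [exact: osp_arules9 | exact: commf_swap13].
Qed.

Lemma twist_osp u w : borel u -> osp1 w -> commf u w -> osp1 (twist u w).
Proof.
move=> hu hw huw; pose I (i : irgen) : R := 0.
have hr := hole_rulesP I hu hw huw; clearbody I.
rewrite /osp1 /=; do ?split; nc hs hd hr s u I w.
Qed.

Lemma irof_twist u w : borel u -> osp1 w -> commf u w ->
  irof (twist u w) =1 itwist u (irof w).
Proof.
move=> hu hw huw; pose I (i : irgen) : R := 0.
have hr := hole_rulesP I hu hw huw; clearbody I.
case; rewrite /irof /=; nc hs hd hr s u I w.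
Qed.

Definition adhole_rules : seq arule :=
  hole_rules ++ act_arules ++ swap_arules ilet ulet.

Lemma adhole_rulesP u I w : borel u -> osp1 w -> commf u w -> commf u I -> adrel w I ->
  arules_ok s (lenv u I w) adhole_rules.
Proof.
move=> hu hw huw hui hwi; apply: arules_ok_cat; first exact: hole_rulesP.
by apply: arules_ok_cat; [exact: act_arulesP | exact: commf_swap12].
Qed.

(** First half of the step at a position outside A; the second half is the conjugation handled by
    [adrel_cj]. *)
Lemma adrel_twist u I w : borel u -> osp1 w -> commf u w -> commf u I -> adrel w I ->
  adrel (twist u w) (itwist u I).
Proof.
move=> hu hw huw hui hwi; have hr := adhole_rulesP hu hw huw hui hwi.
rewrite /adrel /=; do ?split; last case=> /=; nc hs hd hr s u I w.
Qed.

Definition rmatX u w : R := u GAp * u GK * (w GAm * w GKi * w GP).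

(** The commutator of X with a twisted generator. Moving X past it with the factor -q leaves the
    remainder [rmatY'], which X passes with the factor q^2 and no remainder: these are the
    hypotheses of [qexp_conj] with p = -q. *)
Definition rmatY u I (i : irgen) : R :=
  match i with
  | IRa => - (s^-1 * s^-1) *: (u GAp * u GKi * u GP * (I IRc + (s + s^-1) *: I IRg))
  | IRc => (1 + s^-1 * s^-1) *: (u GAp * u GK * I IRb)
  | _ => 0
  end.

Definition rmatY' u I (i : irgen) : R :=
  match i with
  | IRa => - ((1 + s^-1 * s^-1) * s^-1) *: (u GAp * u GAp * u GP * I IRb)
  | _ => 0
  end.

Lemma rmatXA u I w i : borel u -> osp1 w -> commf u w -> commf u I -> adrel w I ->
  rmatX u w * itwist u I i = itwist u I i * rmatX u w + rmatY u I i.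
Proof.
move=> hu hw huw hui hwi; have hr := adhole_rulesP hu hw huw hui hwi.
rewrite /rmatX; case: i => /=; nc hs hd hr s u I w.
Qed.

Lemma rmatXY u I w i : borel u -> osp1 w -> commf u w -> commf u I -> adrel w I ->
  rmatX u w * rmatY u I i = (- (s * s)) *: (rmatY u I i * rmatX u w) + rmatY' u I i.
Proof.
move=> hu hw huw hui hwi; have hr := adhole_rulesP hu hw huw hui hwi.
rewrite /rmatX; case: i => /=; nc hs hd hr s u I w.
Qed.

Lemma rmatXY' u I w i : borel u -> osp1 w -> commf u w -> commf u I -> adrel w I ->
  rmatX u w * rmatY' u I i = (- (s * s) * - (s * s)) *: (rmatY' u I i * rmatX u w).
Proof.
move=> hu hw huw hui hwi; have hr := adhole_rulesP hu hw huw hui hwi.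
rewrite /rmatX; case: i => /=; nc hs hd hr s u I w.
Qed.

(** With p = -q the factor 1 - s^2 is 1 + p, so the right-hand side is exactly the conjugate of the
    twisted generator given by [qexp_conj]. *)
Lemma irtau_twist u I w i : borel u -> osp1 w -> commf u w -> commf u I -> adrel w I ->
  irtau u I i = itwist u I i + (1 - s * s) *: (rmatY u I i + rmatY' u I i).
Proof.
move=> hu hw huw hui hwi; have hr := adhole_rulesP hu hw huw hui hwi.
rewrite /irtau; case: i => /=; nc hs hd hr s u I w.
Qed.

(* The counit, on the generators of osp_q(1|2) and of I_R. *)
Definition osp_eps (g : gen) : R := match g with GAp | GAm => 0 | _ => 1 end.
Definition ir_eps_coef (i : irgen) : K :=
  match i with IRa | IRb => 0 | IRc => 1 | IRg => (qdiff s)^-1 * (s^-1 - s) end.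
Definition ir_eps (i : irgen) : R := (ir_eps_coef i)%:A.

Lemma osp1_eps : osp1 osp_eps.
Proof.
rewrite /osp1 /= !mulr1 !(mul0r, mulr0, scaler0, addr0, subrr).
by do ?split.
Qed.

Lemma irof_eps : irof osp_eps =1 ir_eps.
Proof.
have hr : arules_ok s (lenv osp_eps ir_eps osp_eps) [::] by [].
case; rewrite /irof /ir_eps /= ?scale0r ?scale1r ?mulr1 ?mul0r //;
  nc hs hd hr s osp_eps ir_eps osp_eps.
Qed.

Lemma irdelta_eps u : irdelta u ir_eps =1 irof u.
Proof.
have hr : arules_ok s (lenv u ir_eps u) [::] by [].
by case; rewrite /irof /irdelta /= /ir_eps /= ?scale0r; nc hs hd hr s u ir_eps u.
Qed.

Lemma irtau_eps u : irtau u ir_eps =1 ir_eps.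
Proof.
have hr : arules_ok s (lenv u ir_eps u) [::] by [].
by case; rewrite /irtau /= /ir_eps /= ?scale0r; nc hs hd hr s u ir_eps u.
Qed.
End Steps.
End Osp.

(** * The q-exponential *)

Section QExp.
Variables (K : fieldType) (p : K) (R : algType K).
Hypothesis hp : forall k, p ^+ k.+1 != 1.

(* Normalised so that conjugation by [qexp] adds [(1 + p)(y + y')] in [qexp_conj]. *)
Fixpoint qexp_term (X : R) (k : nat) : R :=
  match k with
  | 0 => 1
  | k'.+1 => ((1 - p ^+ 2) / (1 - p ^+ k)) *: (X * qexp_term X k')
  end.

Lemma qexp_termS X k :
  qexp_term X k.+1 = ((1 - p ^+ 2) / (1 - p ^+ k.+1)) *: (X * qexp_term X k).
Proof. by []. Qed.

Definition qexp (X : R) (n : nat) : R := \sum_(k < n) qexp_term X k.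

Lemma qexp_termE X k : exists c, qexp_term X k = c *: X ^+ k.
Proof.
elim: k => [|k [c /= ->]]; first by exists 1; rewrite scale1r expr0.
by rewrite -scalerAr -exprS scalerA; eexists.
Qed.

Lemma qexp_comm X n z : GRing.comm z X -> GRing.comm z (qexp X n).
Proof.
move=> h; rewrite /GRing.comm /qexp mulr_suml mulr_sumr; apply: eq_bigr => k _.
have [c ->] := qexp_termE X k.
by rewrite -scalerAr -scalerAl (commrX k h).
Qed.

Lemma sub1p_neq0 k : 1 - p ^+ k.+1 != 0.
Proof. by rewrite subr_eq0 eq_sym hp. Qed.

Lemma mul_qexp_term X k :
  X * qexp_term X k = ((1 - p ^+ k.+1) / (1 - p ^+ 2)) *: qexp_term X k.+1.
Proof.
rewrite qexp_termS scalerA mulrA divfK ?sub1p_neq0 //.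
by rewrite divff ?sub1p_neq0 // scale1r.
Qed.

(** The index is shifted by two so that the terms of index -1 and -2, equal to 0, are available in
    the recursion. *)
Definition qexp_shift (X : R) (k : nat) : R :=
  if k is k'.+2 then qexp_term X k' else 0.

Lemma qexp_term_conj X z y y' k :
  X * z = z * X + y -> X * y = p *: (y * X) + y' -> X * y' = (p * p) *: (y' * X) ->
  qexp_term X k * z = z * qexp_shift X k.+2 +
    (1 + p) *: (y * qexp_shift X k.+1 + y' * qexp_shift X k).
Proof.
move=> h1 h2 h3; elim: k => [|k IHk].
  by rewrite /= !mulr0 addr0 scaler0 addr0 mul1r mulr1.
set a := 1 - p ^+ 2; set r := a / (1 - p ^+ k.+1).
have ha : a != 0 by exact: sub1p_neq0 1.
have hk : 1 - p ^+ k.+1 != 0 by exact: sub1p_neq0.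
(* Multiplication by X raises the index by one. In the boundary cases of [e1] and [e2] the shifted
   terms are zero or the coefficient vanishes. *)
have e1 : X * qexp_shift X k.+1 = ((1 - p ^+ k) / a) *: qexp_shift X k.+2.
  case: k {IHk r hk} => [|k]; last exact: mul_qexp_term.
  by rewrite /= expr0 subrr mulr0 mul0r scale0r.
have e2 : (p * p) *: (X * qexp_shift X k) = ((p ^+ 2 - p ^+ k.+1) / a) *: qexp_shift X k.+1.
  case: k {IHk r hk e1} => [|[|k]].
  - by rewrite /= mulr0 !scaler0.
  - by rewrite /= mulr0 scaler0 subrr mul0r scale0r.
  rewrite [X * _]mul_qexp_term scalerA mulrA; congr (_ / _ *: _).
  by rewrite mulrBr mulr1 -expr2 -exprD.
have e3 : X * qexp_shift X k.+2 = r^-1 *: qexp_shift X k.+3.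
  by rewrite [LHS]mul_qexp_term invf_div.
have hr : r != 0 by rewrite mulf_neq0 ?invr_neq0.
rewrite qexp_termS -/a -/r -scalerAl -mulrA IHk.
move: e1 e2 e3 {IHk}; move: (qexp_shift X k.+3) (qexp_shift X k.+2) (qexp_shift X k.+1)
  (qexp_shift X k) => S3 S2 S1 S0 e1 e2 e3.
rewrite mulrDr -scalerAr mulrDr.
rewrite !mulrA h1 h2 h3 !mulrDl -!scalerAl -!mulrA e1 e3 -!scalerAr.
rewrite (scalerAr (p * p)) e2 -scalerAr.
move: (y * qexp_shift X k.+2) (y' * qexp_shift X k.+1) => Y Y'.
rewrite !scalerDr !scalerA divff // scale1r -!addrA; congr (_ + _).
rewrite !addrA -scalerDl -addrA -scalerDl; congr (_ *: _ + _ *: _).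
  rewrite /r /a; move: ha hk; rewrite /a (exprS p k); move: (p ^+ k) => x ha hk.
  by field; rewrite ha hk.
rewrite /r /a; move: ha hk; rewrite /a (exprS p k); move: (p ^+ k) => x ha hk.
by field; rewrite ha hk.
Qed.

Lemma qexp_term0 X k n : X ^+ n = 0 -> (n <= k)%N -> qexp_term X k = 0.
Proof.
move=> hX hk; have [c ->] := qexp_termE X k.
by rewrite -(subnK hk) exprD hX mulr0 scaler0.
Qed.

(** Summing [qexp_term_conj] over k yields the sums of the terms shifted by 0, 1 and 2. The
    truncation at n + 2 includes two zero terms, so all three sums equal [qexp X n.+2]. *)
Lemma qexp_conj X n z y y' : X ^+ n = 0 ->
  X * z = z * X + y -> X * y = p *: (y * X) + y' -> X * y' = (p * p) *: (y' * X) ->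
  qexp X n.+2 * z = (z + (1 + p) *: (y + y')) * qexp X n.+2.
Proof.
move=> hX h1 h2 h3; rewrite /qexp mulr_suml.
rewrite (eq_bigr _ (fun (k : 'I_n.+2) _ => qexp_term_conj k h1 h2 h3)) big_split /=.
rewrite -scaler_sumr big_split /=.
rewrite -!mulr_sumr mulrDl -scalerAl mulrDl.
have e k : (n <= k)%N -> qexp_term X k = 0 by exact: qexp_term0.
have -> : \sum_(k < n.+2) qexp_shift X k.+1 = \sum_(k < n.+2) qexp_term X k.
  rewrite -(big_mkord xpredT (fun k => qexp_shift X k.+1)) -(big_mkord xpredT (qexp_term X)).
  by rewrite big_nat_recl // add0r [RHS]big_nat_recr // (e n.+1 (leqnSn n)) Monoid.mulm1.
have -> : \sum_(k < n.+2) qexp_shift X k = \sum_(k < n.+2) qexp_term X k.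
  rewrite -(big_mkord xpredT (qexp_shift X)) -(big_mkord xpredT (qexp_term X)).
  rewrite big_nat_recl // big_nat_recl // !add0r.
  rewrite [RHS]big_nat_recr // (e n.+1 (leqnSn n)) Monoid.mulm1.
  by rewrite [RHS]big_nat_recr // (e n (leqnn n)) Monoid.mulm1.
by [].
Qed.

Lemma nilpotent_unit (x : R) n : x ^+ n = 0 ->
  exists y, (1 - x) * y = 1 /\ y * (1 - x) = 1.
Proof.
move=> hx; exists (\sum_(i < n) x ^+ i).
have e : (1 - x) * (\sum_(i < n) x ^+ i) = 1.
  by rewrite -opprB mulNr -subrX1 hx sub0r opprK.
split=> //; rewrite -[RHS]e; apply/esym/commr_sum => i _; apply: commrX.
by apply: commr_sym; apply: commrB => //; apply: commr1.
Qed.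

(** The sum is 1 - Xz with z commuting with X, so Xz is nilpotent. *)
Lemma qexp_unit X n : X ^+ n = 0 ->
  exists y, qexp X n.+2 * y = 1 /\ y * qexp X n.+2 = 1.
Proof.
move=> hX; pose z := - \sum_(k < n.+1) ((1 - p ^+ 2) / (1 - p ^+ k.+1)) *: qexp_term X k.
have -> : qexp X n.+2 = 1 - X * z.
  rewrite /qexp big_ord_recl /= mulrN opprK; congr (_ + _); rewrite mulr_sumr.
  by apply: eq_bigr => k _; rewrite -scalerAr.
apply: (@nilpotent_unit _ n); rewrite exprMn_comm ?hX ?mul0r //.
apply: commrN; apply: commr_sum => k _; have [c ->] := qexp_termE X k.
rewrite scalerA /GRing.comm -scalerAr -scalerAl; congr (_ *: _).
exact: commrX.
Qed.
End QExp.


(** * Conjugation by an invertible element *)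

Section Conjugation.
Variables (K : fieldType) (s : K) (R : algType K) (F Fi : R).
Hypotheses (hF : F * Fi = 1) (hFi : Fi * F = 1).

Definition cj (x : R) : R := F * x * Fi.

Lemma cjM x y : cj (x * y) = cj x * cj y.
Proof. by rewrite /cj !mulrA -[F * x * Fi * F]mulrA hFi mulr1. Qed.
Lemma cjD x y : cj (x + y) = cj x + cj y.
Proof. by rewrite /cj mulrDr mulrDl. Qed.
Lemma cjN x : cj (- x) = - cj x.
Proof. by rewrite /cj mulrN mulNr. Qed.
Lemma cjZ c x : cj (c *: x) = c *: cj x.
Proof. by rewrite /cj -scalerAr -scalerAl. Qed.
Lemma cj1 : cj 1 = 1.
Proof. by rewrite /cj mulr1. Qed.
Lemma cj0 : cj 0 = 0.
Proof. by rewrite /cj mulr0 mul0r. Qed.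

Lemma teval_cj (V : Type) (v : V -> R) t : teval (fun x => cj (v x)) t = cj (teval v t).
Proof.
elim: t => //= [c|a -> b ->|a -> b ->]; first by rewrite cjZ cj1.
  by rewrite cjD.
by rewrite cjM.
Qed.

Lemma osp1_cj (u : gen -> R) : osp1 s u -> osp1 s (fun g => cj (u g)).
Proof.
case=> h1 [h2 [h3 [h4 [h5 [h6 [h7 [h8 [h9 h10]]]]]]]].
rewrite /osp1 -!(cjM, cjZ, cjD, cjN) h1 h2 h3 h4 h5 h6 h7 h8 h9 h10 cj0 cj1.
by [].
Qed.

Lemma adrel_cj (w : gen -> R) (I : irgen -> R) :
  adrel s w I -> adrel s (fun g => cj (w g)) (fun i => cj (I i)).
Proof.
case=> h1 [h2 [h3 [h4 [h5 [h6 [h7 [h8 [h9 [h10 [h11 [h12 h13]]]]]]]]]]].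
rewrite /adrel /= -!(cjM, cjZ, cjD, cjN) h1 h2 h3 h4 h5 h6 h7 h8 h9 h10 h11 h12.
by do !split=> //; move=> g; rewrite -!cjM h13.
Qed.
End Conjugation.

(** * The coaction as conjugation, for nilpotent A_+ in the left factor *)

Section Hole.
Variables (K : fieldType) (s : K) (R : algType K).
Hypotheses (hs : s != 0) (hq : forall k : nat, (0 < k)%N -> (s ^+ 2) ^+ k != 1).
Implicit Types (u w : gen -> R) (I : irgen -> R).

Lemma qdiff_neq0 : qdiff s != 0.
Proof.
rewrite /qdiff /qq subr_eq0; apply/eqP => e.
have := hq (isT : (0 < 2)%N); rewrite expr2 {1}e mulVf ?eqxx //.
by rewrite expf_neq0.
Qed.

(** Squaring removes the sign: otherwise q^(2(k+1)) = 1. *)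
Lemma pow_opp_q_neq1 k : (- (s * s)) ^+ k.+1 != 1.
Proof.
apply/eqP => e; have := hq (isT : (0 < k.+1 * 2)%N); apply/negP; rewrite negbK.
by rewrite exprM -(sqrrN (_ ^+ k.+1)) sqrrN expr2 -exprMn -expr2 -sqrrN exprAC expr2 e mulr1.
Qed.

(** Since K and A_+ commute up to a scalar, (A_+K)^n is a multiple of A_+^n K^n. *)
Lemma rmatX_nilp u w n : borel s u -> commf u w -> u GAp ^+ n = 0 -> rmatX u w ^+ n = 0.
Proof.
case=> h [_ [_ [_ [h1 [h2 _]]]]] huw hn; have [e _] := kcomm hs h1 h2 h.
have ek k : exists c, u GK * u GAp ^+ k = c *: (u GAp ^+ k * u GK).
  elim: k => [|k [c IHk]]; first by exists 1; rewrite scale1r expr0 mulr1 mul1r.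
  by exists (c * s); rewrite exprSr mulrA IHk -scalerAl -[_ * u GK * _]mulrA e -scalerAr scalerA mulrA.
have [c ec] : exists c, (u GAp * u GK) ^+ n = c *: (u GAp ^+ n * u GK ^+ n).
  elim: n {hn} => [|k [c IHk]]; first by exists 1; rewrite scale1r !expr0 mulr1.
  have [c' ek'] := ek k; exists (c * c').
  rewrite exprS IHk -scalerAr -mulrA [u GK * _]mulrA ek' -!scalerAl -!scalerAr scalerA.
  by rewrite !exprS !mulrA.
rewrite /rmatX exprMn_comm ?ec ?hn ?mul0r ?scaler0 ?mul0r //.
by do !apply: commrM; apply: commr_sym; do !apply: commrM; apply: commr_sym; apply: huw.
Qed.

Lemma comm_teval (V : Type) (v : V -> R) t z :
  (forall x, GRing.comm z (v x)) -> GRing.comm z (teval v t).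
Proof.
move=> h; elim: t => //= [c|a ha b hb|a ha b hb]; last exact: commrM; last exact: commrD.
by rewrite /GRing.comm mulr_algr mulr_algl.
Qed.

(* [w'] is the conjugate of [twist u w] by the q-exponential of [rmatX u w]. *)
Lemma hole_conj u w n : borel s u -> u GAp ^+ n = 0 -> osp1 s w -> commf u w ->
  exists w', [/\ osp1 s w', irof s w' =1 irtau s u (irof s w),
    forall I, commf u I -> adrel s w I -> adrel s w' (irtau s u I) &
    forall z, (forall g, GRing.comm z (u g)) -> (forall g, GRing.comm z (w g)) ->
      forall g, GRing.comm z (w' g)].
Proof.
move=> hu hn hw huw; have hd := qdiff_neq0; have hp := pow_opp_q_neq1.
have hX : rmatX u w ^+ n = 0 by apply: rmatX_nilp.
have [Fi [hF hFi]] := qexp_unit (- (s * s)) hX.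
set F := qexp _ _ _ in hF hFi.
have key I i : commf u I -> adrel s w I -> cj F Fi (itwist u I i) = irtau s u I i.
  move=> hui hwi; rewrite /cj.
  have -> : F * itwist u I i = irtau s u I i * F.
    rewrite (irtau_twist hs hd i hu hw huw hui hwi).
    by apply: (qexp_conj hp hX); [exact: rmatXA | exact: rmatXY | exact: rmatXY'].
  by rewrite -mulrA hF mulr1.
(* F depends on u and w only, so [key] applies both to a given I and to the I_R generators of w
   itself. *)
have hadw := adrel_irof hs hd hw.
have hirw : commf u (irof s w).
  by move=> g i; apply: comm_teval => x; apply: huw.
exists (fun g => cj F Fi (twist u w g)); split.
- by apply: osp1_cj => //; apply: twist_osp.
- by move=> i; rewrite /irof (teval_cj hF hFi) -/(irof s _ _) (irof_twist hs hd hu hw huw) key.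
- move=> I hui hwi; apply: adrel_ext (fun i => key I i hui hwi) _.
  by apply: adrel_cj => //; apply: adrel_twist.
move=> z hzu hzw g.
have hzF : GRing.comm z F.
  by apply: qexp_comm; rewrite /rmatX; do !apply: commrM.
have hzFi : GRing.comm z Fi.
  by rewrite /GRing.comm -[LHS]mul1r -{1}hFi -!mulrA (mulrA F) -hzF -mulrA hF mulr1.
by apply: commrM => //; apply: commrM => //; case: g => /=; do ?apply: commrM.
Qed.
End Hole.

(** * Nilpotent deformation parameter *)

(* An alias: for a noncommutative [R], ['M[R]_n] is only a left [R]-module in MathComp. *)
Definition kmx (K : fieldType) (R : algType K) (m : nat) : Type := 'M[R]_m.+1.

Section Kmx.
Variables (K : fieldType) (R : algType K) (m : nat).
HB.instance Definition _ := GRing.NzRing.copy (kmx R m) 'M[R]_m.+1.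

Definition kmx_scale (c : K) (A : kmx R m) : kmx R m := map_mx ( *:%R c) (A : 'M[R]_m.+1).

Lemma kmx_scaleA a b v : kmx_scale a (kmx_scale b v) = kmx_scale (a * b) v.
Proof. by apply/matrixP => i j; rewrite !mxE scalerA. Qed.
Lemma kmx_scale1 : left_id 1 kmx_scale.
Proof. by move=> v; apply/matrixP => i j; rewrite !mxE scale1r. Qed.
Lemma kmx_scaleDr : right_distributive kmx_scale +%R.
Proof. by move=> c v w; apply/matrixP => i j; rewrite !mxE scalerDr. Qed.
Lemma kmx_scaleDl v : {morph kmx_scale^~ v : a b / a + b}.
Proof. by move=> a b; apply/matrixP => i j; rewrite !mxE scalerDl. Qed.
HB.instance Definition _ := GRing.Zmodule_isLmodule.Build K (kmx R m)
  kmx_scaleA kmx_scale1 kmx_scaleDr kmx_scaleDl.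

Lemma kmx_scaleAl (c : K) (v w : kmx R m) : c *: (v * w) = c *: v * w.
Proof.
apply/matrixP => i j; rewrite !mxE scaler_sumr; apply: eq_bigr => k _.
by rewrite !mxE scalerAl.
Qed.
HB.instance Definition _ := GRing.Lmodule_isLalgebra.Build K (kmx R m) kmx_scaleAl.

Lemma kmx_scaleAr (c : K) (v w : kmx R m) : c *: (v * w) = v * (c *: w).
Proof.
apply/matrixP => i j; rewrite !mxE scaler_sumr; apply: eq_bigr => k _.
by rewrite !mxE scalerAr.
Qed.
HB.instance Definition _ := GRing.Lalgebra_isAlgebra.Build K (kmx R m) kmx_scaleAr.
End Kmx.

(** * Polynomial identities in a nilpotent parameter *)

Section Transfer.
Variables (K : fieldType) (R : algType K).

(** The nilpotent h, of order m + 1. It commutes with the scalar matrices, and row 0 of h^k is the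
    k-th unit vector for k at most m. *)
Definition shiftmx (m : nat) : 'M[R]_m.+1 := \matrix_(i, j) (j == i.+1 :> nat)%:R.

Lemma shiftmxX m k (i j : 'I_m.+1) : (shiftmx m ^+ k) i j = (j == i + k :> nat)%N%:R.
Proof.
elim: k i j => [|k IHk] i j; first by rewrite expr0 addn0 mxE eq_sym.
rewrite exprS mxE; case: (ltnP i.+1 m.+1) => hi.
  rewrite (bigD1 (Ordinal hi)) //= big1 => [|l hl].
    by rewrite addr0 mxE eqxx mul1r IHk /= addSnnS.
  rewrite mxE; case: eqP => [e|]; last by rewrite mul0r.
  by case/eqP: hl; apply/val_inj.
rewrite big1 => [|l _].
  have -> // : (j == i + k.+1 :> nat)%N = false.
  by apply/eqP => e; have := ltn_ord j; rewrite e addnS ltnS ltnNge (leq_trans (hi : (m <= i)%N)) ?leq_addr.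
rewrite mxE; case: eqP => [e|]; last by rewrite mul0r.
by have := ltn_ord l; rewrite e ltnNge hi.
Qed.

Lemma shiftmx_nilp m : shiftmx m ^+ m.+1 = 0.
Proof.
apply/matrixP => i j; rewrite shiftmxX mxE.
case: eqP => // e; have := ltn_ord j.
by rewrite e ltnNge leq_addl.
Qed.

Lemma scalar_shift_comm m : commr_rmorph (@scalar_mx R m.+1) (shiftmx m).
Proof.
move=> x; rewrite /GRing.comm -[_ * _]/(_ *m _) -[RHS]/(_ *m _) mul_scalar_mx.
apply/matrixP => i j; rewrite !mxE (bigD1 j) //= big1 => [|k hk].
  by rewrite !mxE eqxx addr0 mulr1n; case: (_ == _); rewrite ?mulr1 ?mul1r ?mulr0 ?mul0r.
by rewrite !mxE (negPf hk) mulr0n mulr0.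
Qed.

Definition shift_eval m : {poly R} -> 'M[R]_m.+1 := horner_morph (@scalar_shift_comm m).
HB.instance Definition _ m := GRing.RMorphism.on (shift_eval m).

(** Row 0 of p(h) lists the coefficients of p, so a polynomial of degree at most m is determined by
    its value at h. *)
Lemma shift_eval_coef m (p : {poly R}) (j : 'I_m.+1) :
  (size p <= m.+1)%N -> shift_eval m p 0 j = p`_j.
Proof.
move=> hp; rewrite /shift_eval /horner_morph (horner_coef_wide _ (leq_trans (size_poly _ _) hp)).
rewrite summxE (bigD1 j) //= big1 => [|k hk].
  rewrite addr0 coef_map_id0 ?raddf0 // -mulmxE mul_scalar_mx !mxE shiftmxX.
  by rewrite add0n eqxx mulr1.
rewrite coef_map_id0 ?raddf0 // -mulmxE mul_scalar_mx !mxE shiftmxX add0n.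
by rewrite eq_sym (inj_eq val_inj) (negPf hk) mulr0.
Qed.

Lemma shift_eval_inj m (p : {poly R}) :
  (size p <= m.+1)%N -> shift_eval m p = 0 -> p = 0.
Proof.
move=> hp h; apply/polyP => i; rewrite coef0.
case: (ltnP i m.+1) => hi; last by rewrite nth_default // (leq_trans hp).
by rewrite -(shift_eval_coef (Ordinal hi) hp) h mxE.
Qed.

Definition kmx_embed m (x : R) : kmx R m := x%:M.
Definition kmx_shift m : kmx R m := shiftmx m.

Variables (V : Type) (f : V -> R) (d : V -> bool).

(** The indeterminate plays h, and [d] marks the generators multiplied by it. *)
Fixpoint tpoly (t : term K V) : {poly R} :=
  match t with
  | tvar x => (f x)%:P * 'X^(d x)
  | tconst c => (c%:A)%:P
  | tadd a b => tpoly a + tpoly b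
  | tmul a b => tpoly a * tpoly b
  end.

Lemma tpoly_eval1 t : (tpoly t).[1] = teval f t.
Proof.
have h1 p : comm_poly p (1 : R) by rewrite /comm_poly mul1r mulr1.
elim: t => /= [x|c|a <- b <-|a <- b <-].
- by rewrite hornerM_comm // hornerC hornerXn expr1n mulr1.
- by rewrite hornerC.
- by rewrite hornerD.
- by rewrite hornerM_comm.
Qed.

Lemma tpoly_shift m t :
  shift_eval m (tpoly t) = teval (fun x => kmx_embed m (f x) * kmx_shift m ^+ d x) t.
Proof.
elim: t => /= [x|c|a <- b <-|a <- b <-].
- by rewrite rmorphM rmorphXn /= /shift_eval horner_morphC horner_morphX.
- rewrite /shift_eval horner_morphC; apply/matrixP => i j; rewrite !mxE.
  by case: (_ == _); rewrite ?scaler0.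
- by rewrite rmorphD.
- by rewrite rmorphM.
Qed.

(* An identity between polynomials in [h] may be checked with [h] nilpotent of
   arbitrarily large order, and then specialized to [h = 1]. *)
Lemma teval_eq_nilpotent (t1 t2 : term K V) :
  (forall m, let v x := kmx_embed m (f x) * kmx_shift m ^+ d x in teval v t1 = teval v t2) ->
  teval f t1 = teval f t2.
Proof.
move=> h; rewrite -!tpoly_eval1; congr horner; apply/eqP; rewrite -subr_eq0; apply/eqP.
(* The order of nilpotency is taken above the degree of the difference. *)
apply: (@shift_eval_inj (size (tpoly t1 - tpoly t2))) => //.
by rewrite rmorphB /= !tpoly_shift h subrr.
Qed.
End Transfer.

Section Embed.
Variables (K : fieldType) (R : algType K) (m : nat).

Lemma kmx_embedD (x y : R) : kmx_embed m (x + y) = kmx_embed m x + kmx_embed m y.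
Proof. exact: raddfD. Qed.
Lemma kmx_embedM (x y : R) : kmx_embed m (x * y) = kmx_embed m x * kmx_embed m y.
Proof. exact: scalar_mxM. Qed.
Lemma kmx_embed0 : kmx_embed m (0 : R) = 0.
Proof. exact: raddf0. Qed.
Lemma kmx_embed1 : kmx_embed m (1 : R) = 1.
Proof. by []. Qed.
Lemma kmx_embedZ c (x : R) : kmx_embed m (c *: x) = c *: kmx_embed m x.
Proof. by apply/matrixP => i j; rewrite !mxE; case: (_ == _); rewrite ?scaler0. Qed.
Lemma kmx_embedN (x : R) : kmx_embed m (- x) = - kmx_embed m x.
Proof. exact: raddfN. Qed.
Lemma kmx_shift_nilp : kmx_shift R m ^+ m.+1 = 0.
Proof. exact: shiftmx_nilp. Qed.
Lemma kmx_shift_comm (x : R) : GRing.comm (kmx_embed m x) (kmx_shift R m).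
Proof. exact/commr_sym/scalar_shift_comm. Qed.
End Embed.

(** * Gamma_A as an iterated fold *)

Section Terms.
Variable K : fieldType.

Lemma teval_tsubst (R : algType K) (V W : Type) (v : W -> R) (f : V -> term K W) t :
  teval v (tsubst f t) = teval (fun x => teval v (f x)) t.
Proof. by elim: t => //= a -> b ->. Qed.

Lemma eq_teval_in (R : algType K) (V : Type) (P : V -> bool) (v v' : V -> R) t :
  tvars_ok P t -> (forall x, P x -> v x = v' x) -> teval v t = teval v' t.
Proof.
move=> ht h; by elim: t ht => //= [a ha b hb|a ha b hb] /andP[/ha-> /hb->].
Qed.

Lemma eq_teval (R : algType K) (V : Type) (v v' : V -> R) t : v =1 v' -> teval v t = teval v' t.
Proof. by move=> h; elim: t => //= a -> b ->. Qed.

Lemma tvars_ok_tsubst (V W : Type) (P : V -> bool) (Q : W -> bool) (f : V -> term K W) t :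
  tvars_ok P t -> (forall x, P x -> tvars_ok Q (f x)) -> tvars_ok Q (tsubst f t).
Proof.
move=> ht h; by elim: t ht => //= [a ha b hb|a ha b hb] /andP[/ha-> /hb->].
Qed.
End Terms.

Section Main.
Variables (K : fieldType) (s : K).
Hypotheses (hs : s != 0) (hq : forall k : nat, (0 < k)%N -> (s ^+ 2) ^+ k != 1).

Definition ir_img (D : pred nat) (p : nat) (i : irgen) : mterm K :=
  if D p then delta_img s p i else tau_img s p i.

Definition mlift (D : pred nat) (p : nat) (x : (nat * gen) + irgen) : mterm K :=
  match x with inl y => mv K y.1 y.2 | inr i => ir_img D p i end.

(* Gamma_A over positions [0..p], with symbolic I_R part at position [p], where
   [A] is given by [D] on [0..p-1] and contains [p]. *)
Fixpoint Gterm (D : pred nat) (p : nat) : mterm K :=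
  match p with
  | 0 => mi K IRg
  | p'.+1 => tsubst (mlift D p') (Gterm D p')
  end.

Definition before (p : nat) (x : (nat * gen) + irgen) : bool :=
  match x with inl y => (y.1 < p)%N | inr _ => true end.

Lemma Gterm_before D p : tvars_ok (before p) (Gterm D p).
Proof.
elim: p => //= p IHp; apply: tvars_ok_tsubst IHp _ => -[[i g] /= hi|i _] /=.
  exact: ltnW.
by rewrite /ir_img; case: (D p); case: i; rewrite /= ?ltnSn.
Qed.

Section Eval.
Variable R : algType K.
Implicit Types (v : nat -> gen -> R) (I : irgen -> R).

Definition ienv v I (x : (nat * gen) + irgen) : R :=
  match x with inl y => v y.1 y.2 | inr i => I i end.

Definition istep (D : pred nat) v (p : nat) I : irgen -> R :=
  if D p then irdelta s (v p) I else irtau s (v p) I.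

Definition ifold (D : pred nat) v I (l : seq nat) : irgen -> R := foldr (istep D v) I l.

Lemma eq_istep D v p I I' : I =1 I' -> istep D v p I =1 istep D v p I'.
Proof. by move=> h i; rewrite /istep; case: ifP => _; apply: eq_teval => -[]. Qed.

Lemma eq_ifold D v l I I' : I =1 I' -> ifold D v I l =1 ifold D v I' l.
Proof. by move=> h; elim: l => //= i l IHl; apply: eq_istep. Qed.

Lemma teval_mlift D v I p x : teval (ienv v I) (mlift D p x) = ienv v (istep D v p I) x.
Proof. by case: x => [[i g]|i] //=; rewrite /ir_img /istep; case: (D p); case: i. Qed.

(** The outermost substitution, at the last position, is the first to act on I; hence a right
    fold. *)
Lemma teval_Gterm D v I p : teval (ienv v I) (Gterm D p) = ifold D v I (iota 0 p) IRg.
Proof.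
elim: p I => [//|p IHp] I; rewrite [Gterm _ _]/= teval_tsubst.
by rewrite (eq_teval _ (teval_mlift D v I p)) IHp -[in RHS]addn1 iotaD add0n /ifold foldr_cat.
Qed.

Lemma teval_emb v p t :
  teval (fun x => v x.1 x.2) (tsubst (emb s p) t) = teval (ienv v (irof s (v p))) t.
Proof. by rewrite teval_tsubst; apply: eq_teval => -[[i g]|[]]. Qed.

Lemma osp_rel_osp1 n v i : osp_rel s n v -> (i < n)%N -> osp1 s (v i).
Proof. by case=> h _ hi; apply: h. Qed.

Lemma osp_rel_comm n v i j : osp_rel s n v -> (i < n)%N -> (j < n)%N -> i != j ->
  commf (v i) (v j).
Proof. by case=> _ h hi hj hij g g'; apply: h. Qed.

Lemma osp_relW m n v : (m <= n)%N -> osp_rel s n v -> osp_rel s m v.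
Proof.
move=> hmn [h1 h2]; split=> [i hi|i j hi hj]; first by apply: h1; apply: leq_trans hmn.
by apply: h2; apply: leq_trans hmn.
Qed.

Lemma osp_rel_ext n v v' : (forall i, (i < n)%N -> v i = v' i) -> osp_rel s n v -> osp_rel s n v'.
Proof.
move=> e [h1 h2]; split=> [i hi|i j hi hj]; rewrite -!e //; first exact: h1.
exact: h2.
Qed.

Lemma osp_rel_shift n a v : osp_rel s (n + a) v -> osp_rel s n (fun i => v (i + a)%N).
Proof.
case=> h1 h2; split=> [i hi|i j hi hj hij]; first by apply: h1; rewrite ltn_add2r.
by apply: h2; rewrite ?ltn_add2r // eqn_add2r.
Qed.

Definition snocrep v p (w : gen -> R) (i : nat) : gen -> R := if (i < p)%N then v i else w.

Lemma osp_rel_snoc v p w :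
  (forall i, (i < p)%N -> osp1 s (v i)) -> osp1 s w ->
  (forall i j, (i < p)%N -> (j < p)%N -> i != j -> commf (v i) (v j)) ->
  (forall i, (i < p)%N -> commf (v i) w) ->
  osp_rel s p.+1 (snocrep v p w).
Proof.
move=> h1 hw h2 h3; split=> [i hi|i j].
  by rewrite /snocrep; case: ifP => [/h1|].
rewrite !ltnS (leq_eqVlt i) (leq_eqVlt j) /snocrep => /orP[/eqP->|hi] /orP[/eqP->|hj];
  rewrite ?eqxx // ?ltnn.
- by move=> _ g h; rewrite hj (h3 j).
- by move=> _ g h; rewrite hi h3.
by move=> hij g h; rewrite hi hj h2.
Qed.
End Eval.

(** * Rescaling A_+ by h at chosen positions *)

Section Scaling.
Variables (R : algType K) (v : nat -> gen -> R) (H : pred nat) (m : nat).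

Definition is_Ap (g : gen) : bool := if g is GAp then true else false.
Definition hscale (x : nat * gen) : bool := H x.1 && is_Ap x.2.

Definition hrep (i : nat) (g : gen) : kmx R m :=
  kmx_embed m (v i g) * kmx_shift R m ^+ hscale (i, g).

Lemma hrep_osp1 i : ~~ H i -> osp1 s (v i) -> osp1 s (hrep i).
Proof.
move=> /negPf hi [h1 [h2 [h3 [h4 [h5 [h6 [h7 [h8 [h9 h10]]]]]]]]].
rewrite /osp1 /hrep /hscale /= !hi /= !expr0 !mulr1.
rewrite -!(kmx_embedM, kmx_embedZ, kmx_embedD, kmx_embedN) h1 h2 h3 h4 h5 h6 h7 h8 h9 h10.
by rewrite kmx_embed0 kmx_embed1.
Qed.

Lemma hrep_borel i : osp1 s (v i) -> borel s (hrep i).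
Proof.
move=> /borel_of_osp1[h1 [h4 [h6 [h7 [h8 [h9 h10]]]]]].
rewrite /borel /hrep /hscale /= !andbF !expr0 !mulr1; set E := _ ^+ _.
have hE x : kmx_embed m x * E = E * kmx_embed m x by apply: commrX; apply: kmx_shift_comm.
rewrite -!mulrA -!hE !mulrA -!kmx_embedM h1 kmx_embedZ -scalerAl h6 h7 h8 h9 h10.
do !split=> //.
by rewrite -mulrDl -kmx_embedD h4 kmx_embed0 mul0r.
Qed.

Lemma hrep_nilp i : H i -> hrep i GAp ^+ m.+1 = 0.
Proof.
move=> hi; rewrite /hrep /hscale /= hi exprMn_comm; last exact: kmx_shift_comm.
by rewrite expr1 kmx_shift_nilp mulr0.
Qed.

Lemma hrep_comm i j : commf (v i) (v j) -> commf (hrep i) (hrep j).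
Proof.
move=> h g g'; rewrite /hrep.
have hE x k : GRing.comm (kmx_embed m x) (kmx_shift R m ^+ k).
  by apply: commrX; apply: kmx_shift_comm.
apply: commrM; apply: commr_sym; apply: commrM.
- by rewrite /GRing.comm -!kmx_embedM h.
- by apply: hE.
- by apply/commr_sym/hE.
by apply: commrX; apply: commr_sym; apply: commrX.
Qed.
End Scaling.

Definition tau_subst (p : nat) (x : (nat * gen) + irgen) : term K (nat * gen) :=
  match x with
  | inl y => ov K y.1 y.2
  | inr i => tsubst (emb s p.+1) (tau_img s p i)
  end.

Lemma teval_tau_subst (R : algType K) (v : nat -> gen -> R) p t :
  teval (fun x => v x.1 x.2) (tsubst (tau_subst p) t)
  = teval (ienv v (irtau s (v p) (irof s (v p.+1)))) t.
Proof.
rewrite teval_tsubst; apply: eq_teval => -[[i g]|i] //=.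
by rewrite teval_emb; case: i.
Qed.

(* [1^{(x)p} (x) tau_R] is well defined: once [A_+] in position [p] is multiplied by a
   nilpotent [h], applying it amounts to evaluating in another representation of
   osp^{(x)(p+1)}. *)
Lemma tau_subst_wd p (Q1 Q2 : mterm K) :
  tvars_ok (before p) Q1 -> tvars_ok (before p) Q2 ->
  osp_eq s p.+1 (tsubst (emb s p) Q1) (tsubst (emb s p) Q2) ->
  osp_eq s p.+2 (tsubst (tau_subst p) Q1) (tsubst (tau_subst p) Q2).
Proof.
move=> ok1 ok2 hQ R v hv.
apply: (teval_eq_nilpotent (d := hscale (pred1 p))) => m /=.
rewrite -/(hrep v (pred1 p) m).
pose vS := hrep v (pred1 p) m.
have hp : osp1 s (v p) by apply: osp_rel_osp1 hv _.
have hc i j : (i <= p.+1)%N -> (j <= p.+1)%N -> i != j -> commf (vS i) (vS j).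
  by move=> hi hj hij; apply: hrep_comm; apply: osp_rel_comm hv _ _ hij.
have ho i : (i <= p.+1)%N -> i != p -> osp1 s (vS i).
  by move=> hi hip; apply: hrep_osp1 => //; apply: osp_rel_osp1 hv _.
have hnp : p.+1 != p by rewrite -addn1 -[X in _ != X]addn0 eqn_add2l.
have [|w' [hw' hir _ hcw]] := hole_conj hs hq (hrep_borel (pred1 p) m hp)
    (hrep_nilp v m (eqxx p)) (ho p.+1 (leqnn _) hnp) _.
  by apply: hc => //; rewrite eq_sym.
(* Positions p and p + 1 are merged into one that carries w', giving a representation in which the
   hypothesis on Q1 and Q2 can be used. *)
pose v' := snocrep vS p w'.
have hv' : osp_rel s p.+1 v'.
  have hle i : (i < p)%N -> (i <= p.+1)%N by move=> hi; apply/leqW/ltnW.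
  apply: osp_rel_snoc => // [i hi|i j hi hj|i hi g g'].
  - by apply: ho; [exact: hle | rewrite ltn_eqF].
  - by apply: hc; exact: hle.
  apply: hcw => h.
    by apply: (hc i p); [exact: hle | exact: leqnSn | rewrite ltn_eqF].
  by apply: (hc i p.+1); [exact: hle | exact: leqnn | rewrite ltn_eqF // ltnS ltnW].
have e Q : tvars_ok (before p) Q ->
    teval (fun x => vS x.1 x.2) (tsubst (tau_subst p) Q) =
    teval (fun x => v' x.1 x.2) (tsubst (emb s p) Q).
  move=> ok; rewrite teval_tau_subst teval_emb; apply: eq_teval_in ok _ => -[[i g] /= hi|i _] /=.
    by rewrite /v' /snocrep hi.
  by rewrite /v' /snocrep ltnn hir.
by rewrite [LHS](e _ ok1) [RHS](e _ ok2); apply: hQ.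
Qed.

(** The invariant of the iteration: t has an explicit expression with its last factor in I_R, as
    tau_R requires. *)
Definition represents (D : pred nat) (p : nat) (t : term K (nat * gen)) : Prop :=
  osp_eq s p.+1 (tsubst (emb s p) (Gterm D p)) t.

Lemma represents_Delta (D : pred nat) p t :
  D p -> represents D p t -> represents D p.+1 (Delta p t).
Proof.
(* The pullback of v along the coproduct at p: positions p and p + 1 are merged by [tens], later
   ones move down by one. *)
move=> hD ht R v hv; pose v' := fun i => if (i < p)%N then v i
  else if i == p then tens (v p) (v p.+1) else v i.+1.
have hp : osp1 s (v p) by apply: osp_rel_osp1 hv _.
have hp1 : osp1 s (v p.+1) by apply: osp_rel_osp1 hv _.
have hpp : commf (v p) (v p.+1) by apply: osp_rel_comm hv _ _ _; rewrite // ltn_eqF.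
have e : teval (fun x => v x.1 x.2) (Delta p t) = teval (fun x => v' x.1 x.2) t.
  rewrite /Delta teval_tsubst; apply: eq_teval => -[i g] /=; rewrite /v'.
  case: ltnP => _ //; case: eqP => _ //.
  by case: g.
have hv' : osp_rel s p.+1 v'.
  apply: (@osp_rel_ext _ _ (snocrep v p (tens (v p) (v p.+1)))) => [i|].
    rewrite ltnS leq_eqVlt /snocrep /v' => /orP[/eqP->|->] //.
    by rewrite ltnn eqxx.
  have hle i : (i < p)%N -> (i < p.+2)%N by move=> hi; apply/leqW/leqW.
  apply: osp_rel_snoc => [i hi||i j hi hj|i hi g g'].
  - by apply: osp_rel_osp1 hv (hle _ hi).
  - exact (tens_osp hs (qdiff_neq0 hs hq) hp hp1 hpp).
  - exact: osp_rel_comm hv (hle _ hi) (hle _ hj).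
  apply: comm_teval => -[j h] /=; case: ifP => _.
    by apply: (osp_rel_comm hv (hle _ hi) (leqnSn p.+1)); rewrite ltn_eqF.
  by apply: (osp_rel_comm hv (hle _ hi) (leqnn p.+2)); rewrite ltn_eqF // leqW.
rewrite e -(ht R v' hv') !teval_emb [Gterm D p.+1]/= teval_tsubst (eq_teval _ (teval_mlift D v _ p)).
apply: eq_teval_in (Gterm_before D p) _ => -[[i g] /= hi|i _] /=; first by rewrite /v' hi.
rewrite /v' ltnn eqxx (irof_tens hs (qdiff_neq0 hs hq) hp hp1 hpp).
by rewrite /istep hD.
Qed.

(** The expression chosen by [epsilon] exists because [Gterm D p] is one, and by [tau_subst_wd] the
    choice does not affect the result. *)
Lemma represents_tauR (D : pred nat) p t :
  ~~ D p -> represents D p t -> represents D p.+1 (tauR s p t).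
Proof.
move=> hD ht; rewrite /tauR; set P := fun Q : mterm K => _ /\ _.
have hP : P (epsilon (inhabits (tconst 0 : mterm K)) P).
  by apply: epsilon_spec; exists (Gterm D p); split; first exact: Gterm_before.
case: hP; set Q := epsilon _ _ => hQ1 hQ2 R v hv.
have e : osp_eq s p.+1 (tsubst (emb s p) (Gterm D p)) (tsubst (emb s p) Q).
  by move=> R' u hu; rewrite ht // hQ2.
rewrite -[RHS](tau_subst_wd (Gterm_before D p) hQ1 e hv) teval_tau_subst teval_emb.
rewrite [Gterm D p.+1]/= teval_tsubst (eq_teval _ (teval_mlift D v _ p)).
by rewrite /istep (negPf hD).
Qed.

Lemma represents_taus (D : pred nat) k p t : (forall j, (p <= j < p + k)%N -> ~~ D j) ->
  represents D p t -> represents D (p + k) (taus s k p t).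
Proof.
elim: k p t => [|k IHk] p t hD ht /=; first by rewrite addn0.
rewrite addnS -addSn; apply: IHk => [j /andP[h1 h2]|].
  by apply: hD; rewrite ltnW //= addnS -addSn.
by apply: represents_tauR => //; apply: hD; rewrite leqnn addnS ltnS leq_addr.
Qed.

Lemma path_ltn_last a l x : path ltn a l -> x \in a :: l -> (x <= last a l)%N.
Proof.
elim: l a x => [|b l IHl] a x /=; first by rewrite inE => _ /eqP->.
case/andP=> hab hl; rewrite inE => /orP[/eqP->|]; last exact: IHl.
by apply: ltnW; apply: leq_trans hab (IHl _ _ hl (mem_head _ _)).
Qed.

Lemma represents_muall (D : pred nat) p ds t : path ltn p ds ->
  (forall j, (p <= j < last p ds)%N -> D j = (j \in p :: ds)) ->
  represents D p t -> represents D (last p ds) (muall s p ds t).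
Proof.
elim: ds p t => [|d ds IHd] p t //= /andP[hpd hds] hD ht.
have hle : (d <= last d ds)%N.
  exact: path_ltn_last hds (mem_head _ _).
have hnot j : (j < d)%N -> j \notin d :: ds.
  move=> hj; rewrite inE negb_or ltn_eqF //=; apply/negP => hjd.
  have /allP/(_ _ hjd) := order_path_min ltn_trans hds.
  by rewrite ltnNge ltnW.
apply: IHd => // [j /andP[h1 h2]|].
  rewrite hD; last by rewrite h2 andbT ltnW // (leq_trans hpd).
  by rewrite inE gtn_eqF // (leq_trans hpd).
(* One coproduct moves the last position from p to p + 1, then d - p - 1 coactions move it to d. *)
have ed : (p.+1 + (d - p - 1))%N = d by rewrite -subnDA addn1 subnKC.
rewrite /mu -[X in represents _ X]ed; apply: represents_taus => [j|].
  rewrite ed => /andP[h1 h2]; rewrite hD; last by rewrite ltnW //= (leq_trans h2).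
  by rewrite inE negb_or hnot // andbT gtn_eqF.
apply: represents_Delta ht; rewrite hD ?mem_head //.
by rewrite leqnn (leq_trans hpd).
Qed.

Lemma ifold_shift (R : algType K) D (v : nat -> gen -> R) I l a :
  ifold D v I [seq (i + a)%N | i <- l] =
  ifold (fun i => D (i + a)%N) (fun i => v (i + a)%N) I l.
Proof. by elim: l => //= i l ->. Qed.

(** The coaction fixes the counit, so positions after the last element of A are invisible. *)
Lemma ifold_eps (R : algType K) D (v : nat -> gen -> R) l :
  (forall i, i \in l -> ~~ D i) -> ifold D v (ir_eps s R) l =1 ir_eps s R.
Proof.
elim: l => //= i l IHl h j; rewrite /istep (negPf (h i (mem_head _ _))).
rewrite -(irtau_eps hs (qdiff_neq0 hs hq) (v i)); apply: eq_teval => -[] //= k.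
by apply: IHl => i' hi'; apply: h; rewrite inE hi' orbT.
Qed.

(** The coaction fixes Gamma, so positions before the first element of A are invisible. *)
Lemma ifold_IRg (R : algType K) D (v : nat -> gen -> R) I l :
  (forall i, i \in l -> ~~ D i) -> ifold D v I l IRg = I IRg.
Proof.
elim: l => //= i l IHl h; rewrite /istep (negPf (h i (mem_head _ _))).
by apply: IHl => i' hi'; apply: h; rewrite inE hi' orbT.
Qed.

Lemma teval_GammaSeq (R : algType K) (v : nat -> gen -> R) n c0 a1 rest :
  osp_rel s n v -> path ltn a1 rest -> (last a1 rest < n)%N ->
  teval (fun x => v x.1 x.2) (GammaSeq s c0 (a1 :: rest)) =
  ifold (fun i => i \in a1 :: rest) v (ir_eps s R) (iota 0 n) IRg.
Proof.
move=> hv hpath hlast; rewrite [GammaSeq _ _ _]/= teval_tsubst.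
set ds := [seq _ | _ <- _].
have hall : all (ltn a1) rest by exact: order_path_min ltn_trans hpath.
have hrest : a1 :: rest = [seq (i + a1)%N | i <- 0%N :: ds].
  rewrite /= add0n -map_comp map_id_in // => x /(allP hall) /ltnW hx /=.
  by rewrite subnK.
have [_ hr] : (a1 = 0 + a1)%N /\ rest = [seq (i + a1)%N | i <- ds].
  by case: hrest.
have hds : path ltn 0 ds.
  have := hpath; rewrite [X in path _ _ X]hr -[X in path _ X _]add0n.
  rewrite (@path_map _ _ (addn^~ a1) ltn 0%N).
  by apply: sub_path => x y /=; rewrite ltn_add2r.
have hL : last a1 rest = (last 0 ds + a1)%N.
  by rewrite {1}hr -[X in last X _]add0n (last_map (fun i => i + a1)%N).
pose D := fun j => (j + a1)%N \in a1 :: rest.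
have hmem j : D j = (j \in 0%N :: ds).
  by rewrite /D hrest (@mem_map _ _ (addn^~ a1)) //; apply: addIn.
have h0 : represents D 0 (Gamma_at s (ov K 0)) by [].
have hrep := represents_muall hds (fun j _ => hmem j) h0.
set L := last 0%N ds in hL hrep.
rewrite -(hrep R (fun i => v (i + a1)%N)); last first.
  by apply: osp_rel_shift; apply: osp_relW hv; rewrite addSn -hL.
rewrite (teval_emb (fun i => v (i + a1)%N) L) teval_Gterm.
(* The positions split into those before a1, those from a1 up to the last element, that element, and
   those after it. *)
have -> : n = (a1 + (L + (n - (L + a1).+1).+1))%N.
  by rewrite addnA -addSnnS [(a1 + L)%N]addnC subnKC // -hL.
rewrite !iotaD [in RHS]/ifold !foldr_cat add0n [RHS]ifold_IRg; last first.
  move=> i; rewrite mem_iota add0n inE => hi; rewrite negb_or ltn_eqF //=.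
  by apply/negP => /(allP hall) /=; rewrite ltnNge ltnW.
have -> : iota a1 L = [seq (i + a1)%N | i <- iota 0 L].
  by rewrite -[in LHS](addn0 a1) iotaDl; apply: eq_map => i; rewrite addnC.
rewrite -[RHS]/(ifold _ _ (ifold _ _ _ _) _ _) ifold_shift.
apply: eq_ifold => i /=; rewrite /istep.
rewrite [(a1 + L)%N]addnC -hL mem_last hL.
(* At the last element the coproduct meets the counit and leaves the I_R generators of that
   position. *)
rewrite -(irdelta_eps hs (qdiff_neq0 hs hq)); apply: eq_teval => -[] //= k.
apply/esym/ifold_eps => j; rewrite mem_iota => /andP[hj _].
apply/negP => hjm.
have := path_ltn_last hpath hjm.
by rewrite leqNgt hL hj.
Qed.

Lemma commf_fold (R : algType K) D (v : nat -> gen -> R) l (z : R) :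
  (forall i g, i \in l -> GRing.comm z (v i g)) ->
  forall k, GRing.comm z (ifold D v (ir_eps s R) l k).
Proof.
elim: l => [|i l IHl] h k /=.
  by rewrite /GRing.comm /ir_eps mulr_algr mulr_algl.
rewrite /istep; case: ifP => _; apply: comm_teval => -[[_ g]|k'] /=;
  by [apply: h; rewrite mem_head | apply: IHl => i' g hi'; apply: h; rewrite inE hi' orbT].
Qed.

(* The pair [(w, I_B)] built by folding over the positions from right to left keeps
   satisfying [adrel]; at a position outside A, [w] is conjugated by the same
   q-exponential that realizes tau_R on the I_R-part of B. *)
Lemma ifold_adrel (R : algType K) (DA DB : pred nat) (v : nat -> gen -> R) n l :
  (forall i, DB i -> DA i) -> uniq l ->
  (forall i, i \in l -> DA i -> osp1 s (v i)) ->
  (forall i, i \in l -> ~~ DA i -> borel s (v i) /\ v i GAp ^+ n = 0) ->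
  (forall i j, i \in l -> j \in l -> i != j -> commf (v i) (v j)) ->
  exists w, [/\ osp1 s w, irof s w =1 ifold DA v (ir_eps s R) l,
    adrel s w (ifold DB v (ir_eps s R) l) &
    forall z, (forall i g, i \in l -> GRing.comm z (v i g)) -> forall g, GRing.comm z (w g)].
Proof.
have hd := qdiff_neq0 hs hq.
move=> hBA; elim: l => [|i l IHl] /=.
  move=> _ _ _ _; exists (osp_eps R); split=> [|||z _ g].
  - exact: osp1_eps.
  - exact: irof_eps.
  - apply: (@adrel_ext _ _ _ _ (irof s (osp_eps R))); first exact: irof_eps.
    by apply: adrel_irof => //; apply: osp1_eps.
  - by case: g; [exact: commr0 | exact: commr0 | exact: commr1 | exact: commr1 | exact: commr1].
case/andP=> hil hl hA hnA hcom.
have hin j : j \in l -> j \in i :: l by rewrite inE orbC => ->.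
have [||||w [hw hir had hcw]] := IHl _ _ _ _ => //.
- by move=> j /hin; apply: hA.
- by move=> j /hin; apply: hnA.
- by move=> j k /hin hj /hin; apply: hcom.
have hij j : j \in l -> i != j by move=> hj; apply/eqP => e; rewrite e hj in hil.
have hvv g j g' : j \in l -> GRing.comm (v i g) (v j g').
  by move=> hj; apply: hcom; rewrite ?mem_head ?hin ?hij.
have hvw : commf (v i) w by move=> g h; apply: hcw => j g'; apply: hvv.
have hvI D : commf (v i) (ifold D v (ir_eps s R) l).
  by move=> g h; apply: commf_fold => j g'; apply: hvv.
have hcomm z : (forall g, GRing.comm z (v i g)) -> (forall j g, j \in l -> GRing.comm z (v j g)) ->
    forall g, GRing.comm z (tens (v i) w g).
  by move=> hz hzl g; apply: comm_teval => -[k h] /=; case: ifP => _ //; apply: hcw.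
(* At a position of A, w is tensored with [v i], whether or not the position is in B. *)
case hDA : (DA i).
  have hvi : osp1 s (v i) by apply: hA; rewrite ?mem_head.
  exists (tens (v i) w); split.
  - exact (tens_osp hs hd hvi hw hvw).
  - move=> k; rewrite /istep hDA (irof_tens hs hd hvi hw hvw); apply: eq_teval => -[] //=; exact: hir.
  - rewrite /istep; case: ifP => _.
      exact (adrel_tens_delta hs hd hvi hw hvw (hvI DB) had).
    exact (adrel_tens_tau hs hd hvi hw hvw (hvI DB) had).
  move=> z hz; apply: hcomm => // [g|j g hj]; apply: hz; rewrite ?mem_head ?hin //.
(* Here the inclusion of B in A is used: outside A both folds apply the coaction, and one
   conjugation realises both. *)
have hDB : DB i = false by apply/negP => /hBA; rewrite hDA.
have [hb hn] : borel s (v i) /\ v i GAp ^+ n = 0 by apply: hnA; rewrite ?mem_head ?hDA.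
have [w' [hw' hir' had' hcw']] := hole_conj hs hq hb hn hw hvw.
exists w'; split=> //.
- by move=> k; rewrite /istep hDA hir'; apply: eq_teval => -[] //=; exact: hir.
- by rewrite /istep hDB; apply: had'.
move=> z hz; apply: hcw' => [g|]; first by apply: hz; rewrite mem_head.
by apply: hcw => j g hj; apply: hz; rewrite hin.
Qed.

Definition Gfull (D : pred nat) (n : nat) : term K (nat * gen) :=
  tsubst (fun x => match x with
                   | inl y => ov K y.1 y.2
                   | inr i => tconst (ir_eps_coef s i)
                   end) (Gterm D n).

Lemma teval_Gfull (R : algType K) (v : nat -> gen -> R) D n :
  teval (fun x => v x.1 x.2) (Gfull D n) = ifold D v (ir_eps s R) (iota 0 n) IRg.
Proof.
rewrite -teval_Gterm teval_tsubst.
by apply: eq_teval => -[[i g]|i].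
Qed.

Lemma Gfull_comm (DA DB : pred nat) n : (forall i, DB i -> DA i) ->
  osp_eq s n (tmul (Gfull DA n) (Gfull DB n)) (tmul (Gfull DB n) (Gfull DA n)).
Proof.
(* Only the positions outside A are rescaled: conjugation takes place there, while [tens] needs the
   full relations at positions of A. *)
move=> hBA R v hv; apply: (teval_eq_nilpotent (d := hscale (predC DA))) => m /=.
rewrite -/(hrep v (predC DA) m).
pose vS := hrep v (predC DA) m.
have e D : teval (fun x => vS x.1 x.2) (Gfull D n) = ifold D vS (ir_eps s _) (iota 0 n) IRg.
  exact: teval_Gfull.
have [|i|i|i j|w [_ hir had _]] := @ifold_adrel _ DA DB vS m.+1 (iota 0 n) hBA _ _ _ _.
- exact: iota_uniq.
- rewrite mem_iota => hi hA; apply: hrep_osp1; first by rewrite /= negbK.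
  exact: osp_rel_osp1 hv hi.
- rewrite mem_iota => hi hA; split; first exact: hrep_borel (osp_rel_osp1 hv hi).
  exact: hrep_nilp.
- rewrite !mem_iota => hi hj hij; apply: hrep_comm; exact: osp_rel_comm hv hi hj hij.
have -> : teval (fun x => kmx_embed m (v x.1 x.2) * kmx_shift R m ^+ hscale (predC DA) x) (Gfull DA n)
  = irof s w IRg.
  by rewrite hir -e; apply: eq_teval => -[].
have -> : teval (fun x => kmx_embed m (v x.1 x.2) * kmx_shift R m ^+ hscale (predC DA) x) (Gfull DB n)
  = ifold DB vS (ir_eps s _) (iota 0 n) IRg.
  by rewrite -e; apply: eq_teval => -[].
(* Gamma_A is now a polynomial in the w g, each of which commutes with Gamma_B by the last clause of
   [adrel]. *)
apply/esym/comm_teval => x; apply: commr_sym.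
by case: had => [_ [_ [_ [_ [_ [_ [_ [_ [_ [_ [_ [_ h]]]]]]]]]]]]; apply: h.
Qed.

Lemma teval_GammaSet (R : algType K) (v : nat -> gen -> R) n c0 (A : {set 'I_n}) :
  osp_rel s n v -> A != set0 ->
  teval (fun x => v x.1 x.2) (GammaSet s c0 A) =
  teval (fun x => v x.1 x.2) (Gfull (fun i => i \in [seq val i | i <- enum A]) n).
Proof.
move=> hv hA; rewrite teval_Gfull /GammaSet.
set l := [seq val i | i <- enum A].
have hmem i : (i \in sort leq l) = (i \in l) by rewrite mem_sort.
have hs1 : sorted ltn (sort leq l).
  rewrite ltn_sorted_uniq_leq sort_uniq map_inj_uniq ?enum_uniq /=; last exact: val_inj.
  by apply: sort_sorted; apply: leq_total.
have hlt i : i \in l -> (i < n)%N by case/mapP => j _ ->; apply: ltn_ord.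
have hne : l != [::].
  apply: contra hA => /eqP hl; apply/eqP/setP => i; rewrite inE.
  by apply/negP => hi; have := map_f val (_ : i \in enum A); rewrite -/l hl mem_enum => /(_ hi).
case e : (sort leq l) hs1 hmem => [|a1 rest] hs1 hmem.
  by case: (l) hne hmem => // a l' _ /(_ a); rewrite mem_head.
rewrite (@teval_GammaSeq _ _ n) //; last first.
  by apply: hlt; rewrite -hmem mem_last.
have eD : forall l' I, ifold (fun i => i \in a1 :: rest) v I l' =1 ifold (fun i => i \in l) v I l'.
  elim=> // i l' IH I k; rewrite [LHS]/= [RHS]/= /istep hmem.
  by case: ifP => _; apply: eq_teval => -[] //=; apply: IH.
exact: eD.
Qed.
End Main.

Theorem theorem8p2 (K : fieldType) (q12 : K) (hq0 : q12 != 0)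
  (hq : forall k : nat, (0 < k)%N -> (q12 ^+ 2) ^+ k != 1)
  (c0 : K) (n : nat) (hn : (1 <= n)%N) (A B : {set 'I_n}) (hBA : B \subset A) :
  osp_eq q12 n (tmul (GammaSet q12 c0 A) (GammaSet q12 c0 B))
               (tmul (GammaSet q12 c0 B) (GammaSet q12 c0 A)).
Proof.
move=> R v hv /=.
have h0 : teval (fun x => v x.1 x.2) (GammaSet q12 c0 (set0 : {set 'I_n})) = c0%:A.
  by rewrite /GammaSet enum_set0.
(* The empty set gives a scalar, which is not obtained from the fold and is treated apart. *)
have [->|hB] := eqVneq B set0; first by rewrite h0 -scalerAl -scalerAr mul1r mulr1.
have [->|hA] := eqVneq A set0; first by rewrite h0 -scalerAl -scalerAr mul1r mulr1.
rewrite !teval_GammaSet //; apply: Gfull_comm hv => // i /mapP[j hj ->].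
by rewrite map_f // mem_enum (subsetP hBA) // -mem_enum.
Qed.
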